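(* Let $\ell\le4$ and let $\mathcal{A}$ be an arrangement in $V=\mathbb{K}^\ell$. Then whether $\mathcal{A}$ has a free filtration depends only on its intersection lattice $L(\mathcal{A})$; that is, if $\mathcal{A}$ and $\mathcal{B}$ are arrangements in $\mathbb{K}^\ell$ with $L(\mathcal{A})\cong L(\mathcal{B})$ as partially ordered sets, then $\mathcal{A}$ has a free filtration if and only if $\mathcal{B}$ does.
   Context: Let $\mathbb{K}$ be a field, $V=\mathbb{K}^\ell$, $S=\mathrm{Sym}^*(V^* )=\mathbb{K}[x_1,\ldots,x_\ell]$ and $\mathrm{Der}\,S=\bigoplus_{i=1}^\ell S\partial_{x_i}$. An arrangement $\mathcal{A}$ in $V$ is a finite set of linear hyperplanes in $V$; arrangements are assumed essential ($\bigcap_{H\in\mathcal{A}}H=\{0\}$) unless otherwise specified. For $H\in\mathcal{A}$ fix $\alpha_H\in V^*$ with $\ker\alpha_H=H$. $D(\mathcal{A}):=\{\theta\in\mathrm{Der}\,S\mid\theta(\alpha_H)\in S\alpha_H\ (\forall H\in\mathcal{A})\}$, and $\mathcal{A}$ is free if $D(\mathcal{A})$ is a free $S$-module (with a homogeneous basis). The intersection lattice is $L(\mathcal{A}):=\{\bigcap_{H\in\mathcal{C}}H\mid\mathcal{C}\subset\mathcal{A}\}$ (including $V$), partially ordered by reverse inclusion. $\mathcal{A}$ has a free filtration if there is a chain $\emptyset=\mathcal{A}_0\subset\mathcal{A}_1\subset\cdots\subset\mathcal{A}_n=\mathcal{A}$ of subarrangements with $|\mathcal{A}_i|=i$ and $\mathcal{A}_i$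 free for $i=0,\ldots,n$ (the $\mathcal{A}_i$ are not required to be essential). *)

(* Defs.v *)
From mathcomp Require Import all_boot all_algebra finmap.
From mathcomp Require Import freeg mpoly.

Set Implicit Arguments.
Unset Strict Implicit.
Unset Printing Implicit Defensive.

Import GRing.Theory.

Local Open Scope ring_scope.
Local Open Scope fset_scope.

Section Arrangements.

Variables (K : fieldType) (l : nat).

Notation V := 'rV[K]_l.
Notation S := {mpoly K[l]}.

(* [(\dim H).+1 = l] rather than [\dim H = l.-1], so that [K^0] has no
   hyperplane. *)
Definition is_arrangement (A : {fset {vspace V}}) : Prop :=
  forall H : {vspace V}, H \in A -> (\dim H).+1 = l.

Definition essential (A : {fset {vspace V}}) : Prop :=
  (\bigcap_(H <- A) H)%VS = 0%VS.

(* A linear form as an element of [S]: the variable ['X_i] is the [i]-th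
   coordinate function on [V]. *)
Definition linform_poly (a : 'Hom(V, K^o)) : S :=
  \sum_(i < l) (a (delta_mx 0 i) : K) *: 'X_i.

(* The row vector [t] stands for the derivation [\sum_i t_i d/dx_i]. *)
Definition der_apply (t : 'rV[S]_l) (f : S) : S :=
  \sum_(i < l) t 0 i * f^`M(i).

(* A linear form with kernel [H] is determined by [H] up to a nonzero scalar,
   which does not change the ideal it generates; quantifying over all such
   forms thus amounts to fixing one form for each [H]. *)
Definition in_D (A : {fset {vspace V}}) (t : 'rV[S]_l) : Prop :=
  forall H : {vspace V}, H \in A ->
  forall a : 'Hom(V, K^o), lker a = H ->
  exists g : S, der_apply t (linform_poly a) = g * linform_poly a.

Definition der_homog (d : nat) (t : 'rV[S]_l) : Prop :=
  forall i : 'I_l, t 0 i \is d.-homog.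

Definition is_basis (M : 'rV[S]_l -> Prop) (n : nat) (b : 'I_n -> 'rV[S]_l) :
    Prop :=
  [/\ forall i : 'I_n, M (b i),
      forall t : 'rV[S]_l, M t ->
        exists c : 'I_n -> S, t = \sum_(i < n) c i *: b i
    & forall c : 'I_n -> S,
        \sum_(i < n) c i *: b i = 0 -> forall i : 'I_n, c i = 0].

(* Finite bases suffice: [D(A)] is a submodule of the Noetherian module
   [S^l]. *)
Definition free_arr (A : {fset {vspace V}}) : Prop :=
  exists (n : nat) (b : 'I_n -> 'rV[S]_l),
    is_basis (in_D A) b /\
    forall i : 'I_n, exists d : nat, der_homog d (b i).

Definition free_filtration (A : {fset {vspace V}}) : Prop :=
  exists (n : nat) (F : nat -> {fset {vspace V}}),
    [/\ F 0%N = fset0,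
        F n = A,
        forall i : nat, (i < n)%N -> F i `<=` F i.+1
      & forall i : nat, (i <= n)%N -> #|` F i| = i /\ free_arr (F i)].

(* [C = fset0] contributes the whole space [V]. *)
Definition intersection_lattice (A : {fset {vspace V}}) :
    {fset {vspace V}} :=
  [fset (\bigcap_(H <- C) H)%VS | C : {fset {vspace V}} in fpowerset A].

Definition lattice_le (A : {fset {vspace V}})
    (X Y : intersection_lattice A) : bool :=
  (val Y <= val X)%VS.

Definition lattice_iso (A B : {fset {vspace V}}) : Prop :=
  exists f : intersection_lattice A -> intersection_lattice B,
    bijective f /\ forall X Y, lattice_le (f X) (f Y) = lattice_le X Y.

End Arrangements.

(* Main.v *)
(* Let [A = A' + H] with [A'] free, [x] the form of [H], [B] Terao's polynomial,
   of degree [D = |A'| - |A^H|]. Every [t] in [D(A')] satisfies [t(x) = B c]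
   modulo [x], and the values [c] form, together with [x], an ideal [I]. Then
   [A] is free iff [I = (1)], in which case an exponent [D] of [A'] becomes
   [D + 1]. The condition [I = (1)] passes to localizations. Conversely, suppose
   that all proper localizations at flats inside [H] satisfy it and that [D] is
   an exponent of [A'] besides the exponent [1] of the Euler derivation. If [I]
   were proper, it would be primary to the irrelevant ideal (up to the center),
   although it is generated by fewer elements than the rank: the basis elements
   of degree [D] and the Euler derivation contribute nothing. So, by induction
   on the flats and along the filtration, the condition is carried from one
   arrangement to the other together with the exponents.

   Arrangements are encoded by a finite family [a] of normal vectors, [E] being
   the set of the indices of a subarrangement. *)
From HB Require Import structures.
Require Import Defs.
From mathcomp Require Import all_boot all_algebra finmap.
From mathcomp Require Import perm freeg mpoly ring.

Set Implicit Arguments.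
Unset Strict Implicit.
Unset Printing Implicit Defensive.

Import GRing.Theory.

Local Open Scope ring_scope.

(** * Linear forms as prime elements of the polynomial ring *)

Section LinearForms.

Variables (K : fieldType) (l : nat).
Notation S := {mpoly K[l]}.
Implicit Types (a b v : 'rV[K]_l) (f g p q : S).

(** That freeness by itself depends only on the lattice is Terao's conjecture. A filtration helps
    because, when a hyperplane is added, the exponents of [A'] are already known to agree for both
    arrangements and $D$ is combinatorial. In a proper $I$, a basis element of degree $D$
    contributes a constant, hence $0$. The Euler derivation takes $x$ to $x$, which gives a relation
    modulo $x$ between the values $c$, with a nonzero constant coefficient at some exponent $1$;
    that value is redundant, and $x$ takes its place. So two different basis elements are required,
    also when $D = 1$. Members of a filtration need not be essential: linear forms dual to the basis
    elements of degree $0$ cut down the center and keep the count at $l - 1$ generators in $l$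
    variables. That a free step has $I = (1)$ is obtained without homogeneity of the larger basis:
    modulo $x$ the ideal is principal, and its generator divides products without a common
    factor. *)

Definition dvds p f := exists g, f = g * p.

Lemma dvds_mull p f g : dvds p f -> dvds p (g * f).
Proof. by case=> h ->; exists (g * h); rewrite mulrA. Qed.

Lemma dvds_mulr p f g : dvds p f -> dvds p (f * g).
Proof. by rewrite mulrC; apply: dvds_mull. Qed.

Lemma dvds_refl p : dvds p p.
Proof. by exists 1; rewrite mul1r. Qed.

Lemma dvds0 p : dvds p 0.
Proof. by exists 0; rewrite mul0r. Qed.

Lemma dvds_add p f g : dvds p f -> dvds p g -> dvds p (f + g).
Proof. by case=> h -> [k ->]; exists (h + k); rewrite mulrDl. Qed.

Lemma dvds_opp p f : dvds p f -> dvds p (- f).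
Proof. by case=> h ->; exists (- h); rewrite mulNr. Qed.

Lemma dvds_scale p f (c : K) : dvds p f -> dvds p (c *: f).
Proof. by rewrite -mul_mpolyC; apply: dvds_mull. Qed.

Lemma dvds_sum (I : finType) (P : pred I) p (F : I -> S) :
  (forall i, P i -> dvds p (F i)) -> dvds p (\sum_(i | P i) F i).
Proof. by move=> h; elim/big_ind: _ => //; [exact: dvds0|exact: dvds_add]. Qed.

Definition dotv a v : K := \sum_i a 0 i * v 0 i.

Lemma dotvDl a b v : dotv (a + b) v = dotv a v + dotv b v.
Proof. by rewrite /dotv -big_split; apply: eq_bigr => i _; rewrite mxE mulrDl. Qed.

Lemma dotvZl (c : K) a v : dotv (c *: a) v = c * dotv a v.
Proof. by rewrite /dotv mulr_sumr; apply: eq_bigr => i _; rewrite mxE mulrA. Qed.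

Lemma dotvZr (c : K) a v : dotv a (c *: v) = c * dotv a v.
Proof. by rewrite /dotv mulr_sumr; apply: eq_bigr => i _; rewrite mxE mulrCA. Qed.

Lemma dotv_mx a v : a *m v^T = (dotv a v)%:M.
Proof.
apply/rowP=> j; rewrite !mxE ord1 eqxx mulr1n.
by apply: eq_bigr => i _; rewrite mxE.
Qed.

Definition lf a : S := \sum_i a 0 i *: 'X_i.

Lemma lfD a b : lf (a + b) = lf a + lf b.
Proof. by rewrite /lf -big_split; apply: eq_bigr => i _; rewrite mxE scalerDl. Qed.

Lemma lfZ (c : K) a : lf (c *: a) = c *: lf a.
Proof. by rewrite /lf scaler_sumr; apply: eq_bigr => i _; rewrite mxE scalerA. Qed.

Lemma lf0 : lf 0 = 0.
Proof. by rewrite /lf big1 // => i _; rewrite mxE scale0r. Qed.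

Lemma lfN a : lf (- a) = - lf a.
Proof. by rewrite -scaleN1r lfZ scaleN1r. Qed.

Lemma lf_sum (I : finType) (P : pred I) (F : I -> 'rV[K]_l) :
  lf (\sum_(i | P i) F i) = \sum_(i | P i) lf (F i).
Proof. by elim/big_rec2: _ => [|i y1 y2 _ <-]; rewrite ?lf0 ?lfD. Qed.

Lemma lf_delta i : lf (delta_mx 0 i) = 'X_i.
Proof.
rewrite /lf (bigD1 i) //= big1 ?addr0 => [|j ji]; rewrite !mxE ?eqxx ?scale1r //=.
by rewrite (negPf ji) scale0r.
Qed.

Lemma lf_coef a i : (lf a)@_U_(i) = a 0 i.
Proof.
rewrite /lf raddf_sum (bigD1 i) //= big1 ?addr0 => [|j ji].
  by rewrite mcoeffZ mcoeffXU eqxx mulr1.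
by rewrite mcoeffZ mcoeffXU (negPf ji) mulr0.
Qed.

Lemma lf_inj : injective lf.
Proof. by move=> a b ab; apply/rowP => i; rewrite -!lf_coef ab. Qed.

Lemma lf_eq0 a : (lf a == 0) = (a == 0).
Proof. by rewrite -lf0 (inj_eq lf_inj). Qed.

Lemma lf_homog a : lf a \is 1.-homog.
Proof. by apply: rpred_sum => i _; apply: rpredZ; rewrite dhomogX /= mdeg1. Qed.

(* Composition with the projection of the space onto the kernel of [a] along
   [v] (a projection when [dotv a v = 1]). *)
Definition proj a v : S -> S :=
  comp_mpoly [tuple 'X_i - v 0 i *: lf a | i < l].

HB.instance Definition _ a v := GRing.RMorphism.copy (proj a v)
  (comp_mpoly [tuple 'X_i - v 0 i *: lf a | i < l]).

Lemma projZ a v (c : K) f : proj a v (c *: f) = c *: proj a v f.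
Proof. exact: comp_mpolyZ. Qed.

Lemma projX a v i : proj a v 'X_i = 'X_i - v 0 i *: lf a.
Proof. by rewrite /proj comp_mpolyXU -tnth_nth tnth_mktuple. Qed.

Lemma proj_lf a v b : proj a v (lf b) = lf (b - dotv b v *: a).
Proof.
rewrite {1}/lf (raddf_sum (proj a v)) /= lfD lfN lfZ /dotv scaler_suml -sumrB.
by apply: eq_bigr => i _; rewrite projZ projX scalerBr scalerA.
Qed.

Lemma proj_self a v : dotv a v = 1 -> proj a v (lf a) = 0.
Proof. by move=> e; rewrite proj_lf e scale1r subrr lf0. Qed.

(** Each variable changes by a multiple of [lf a], so [proj] is the identity modulo [lf a], for
    every [v]. *)
Lemma dvds_subproj a v f : dvds (lf a) (f - proj a v f).
Proof.
have X m : dvds (lf a) ('X_[m] - proj a v 'X_[m]).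
  rewrite mpolyXE_id; elim/big_rec: _ => [|i f' _ IH].
    by rewrite rmorph1 subrr; apply: dvds0.
  have E k : dvds (lf a) ('X_i ^+ k - proj a v ('X_i ^+ k)).
    elim: k => [|k IHk]; first by rewrite expr0 rmorph1 subrr; apply: dvds0.
    rewrite exprS rmorphM /= projX.
    rewrite (_ : _ - _ = 'X_i * ('X_i ^+ k - proj a v ('X_i ^+ k)) +
       (v 0 i *: lf a) * proj a v ('X_i ^+ k)); last first.
      by ring.
    apply: dvds_add; first exact: dvds_mull.
    by apply: dvds_mulr; apply/dvds_scale/dvds_refl.
  rewrite rmorphM /= (_ : _ - _ = 'X_i ^+ m i * (f' - proj a v f') +
      ('X_i ^+ m i - proj a v ('X_i ^+ m i)) * proj a v f').
    by apply: dvds_add; [exact: dvds_mull|exact: dvds_mulr].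
  by ring.
rewrite [in X in dvds _ X](mpolyE f) (raddf_sum (proj a v)) /= -sumrB.
elim/big_rec: _ => [|m f' _]; first exact: dvds0.
apply: dvds_add; rewrite projZ -scalerBr; apply/dvds_scale/X.
Qed.

Lemma dvds_proj a v f : dotv a v = 1 -> dvds (lf a) f <-> proj a v f = 0.
Proof.
move=> av; split=> [[g ->]|f0]; first by rewrite rmorphM /= proj_self ?mulr0.
by have := dvds_subproj a v f; rewrite f0 subr0.
Qed.

Lemma dotv_ex a : a != 0 -> exists v, dotv a v = 1.
Proof.
move=> a0; have [i ai] : exists i, a 0 i != 0.
  apply/existsP; apply: contraR a0; rewrite negb_exists => /forallP h.
  by apply/eqP/rowP => i; move: (h i); rewrite negbK mxE => /eqP.
exists ((a 0 i)^-1 *: delta_mx 0 i); rewrite /dotv (bigD1 i) //= big1 ?addr0.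
  by rewrite !mxE !eqxx mulr1 divff.
by move=> j ji; rewrite !mxE (negPf ji) andbF !mulr0.
Qed.

Definition prime_elt p := p != 0 /\ forall f g, dvds p (f * g) -> dvds p f \/ dvds p g.

(** The ideal of [lf a] is the kernel of [proj a v], a ring endomorphism of a domain. *)
Lemma lf_prime a : a != 0 -> prime_elt (lf a).
Proof.
move=> a0; split=> [|f g]; first by rewrite lf_eq0.
have [v av] := dotv_ex a0; rewrite !(dvds_proj _ av) rmorphM => /eqP.
by rewrite mulf_eq0 => /orP[] /eqP; [left|right].
Qed.

Lemma dvds_lf a b : a != 0 -> dvds (lf a) (lf b) -> exists c, b = c *: a.
Proof.
move=> a0; have [v av] := dotv_ex a0; rewrite (dvds_proj _ av) proj_lf => /eqP.
by rewrite lf_eq0 subr_eq0 => /eqP ->; exists (dotv b v).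
Qed.

Lemma prime_dvds_prod p (I : finType) (P : pred I) (F : I -> S) :
  ~ dvds p 1 -> prime_elt p -> dvds p (\prod_(i | P i) F i) ->
  exists2 i, P i & dvds p (F i).
Proof.
move=> p1 [_ hp]; elim/big_rec: _ => [//|i f Pi IH /hp[|//]].
by exists i.
Qed.

Lemma lf_not1 a : ~ dvds (lf a) 1.
Proof.
have [->|a0] := eqVneq a 0.
  by case=> g /eqP; rewrite lf0 mulr0 oner_eq0.
have [v av] := dotv_ex a0.
by rewrite (dvds_proj _ av) rmorph1 => /eqP; rewrite oner_eq0.
Qed.

(** * Homogeneous components and divisibility *)

Lemma pihomogM_homog d n p q : p \is d.-homog ->
  pihomog mdeg n (p * q) = if (d <= n)%N then p * pihomog mdeg (n - d) q else 0.
Proof.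
move=> hp; rewrite {1}(pihomog_partitionE (leqnn (mmeasure mdeg q))).
rewrite mulr_sumr raddf_sum /=.
have E (i : 'I_(mmeasure mdeg q)) : pihomog mdeg n (p * pihomog mdeg i q) =
    if (d + i == n)%N then p * pihomog mdeg i q else 0.
  have H : p * pihomog mdeg i q \is (d + i).-homog.
    by apply: dhomogM => //; apply: pihomogP.
  case: eqP => [<-|/eqP ne]; first by rewrite pihomog_dE.
  by rewrite (pihomog_ne0 _ H).
under eq_bigr do rewrite E.
rewrite -big_mkcond /=; case: leqP => dn; last first.
  by rewrite big1 // => i /eqP e; move: dn; rewrite -e ltnNge leq_addr.
have [lt|ge] := ltnP (n - d) (mmeasure mdeg q).
  rewrite (big_pred1 (Ordinal lt)) // => i; rewrite /= -(inj_eq val_inj) /=.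
  by rewrite -{1}(subnKC dn) eqn_add2l.
rewrite big1 => [|i /eqP e]; last by move: ge; rewrite -e addKn leqNgt ltn_ord.
rewrite (_ : pihomog _ _ q = 0) ?mulr0 // pihomogE big1_seq // => m /andP[/eqP e].
by move/mmeasure_mnm_lt=> lt; move: ge; rewrite -e leqNgt => /negP[].
Qed.

Lemma pihomogM_homogr d n p q : p \is d.-homog ->
  pihomog mdeg n (q * p) = if (d <= n)%N then pihomog mdeg (n - d) q * p else 0.
Proof. by move=> hp; rewrite mulrC (pihomogM_homog _ _ hp); case: ifP => // _; rewrite mulrC. Qed.

Lemma pihomog0_mcoeff p : pihomog mdeg 0 p = (p@_0)%:MP.
Proof.
rewrite pihomogE (eq_bigl (fun m => m == 0%MM)); last by move=> m; rewrite mdeg_eq0.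
rewrite -big_filter; case: (boolP (0%MM \in msupp p)) => h.
  rewrite filter_pred1_uniq ?msupp_uniq // big_seq1 mpolyX0.
  by rewrite -mul_mpolyC mulr1.
rewrite (memN_msupp_eq0 h) mpolyC0 (_ : [seq _ <- _ | _] = [::]) ?big_nil //.
apply/eqP; rewrite -(negbK (_ == _)) -has_filter; apply/negP => /hasP[m mi /eqP m0].
by move: h; rewrite -m0 mi.
Qed.

Lemma homog0_const p : p \is 0.-homog -> p = (p@_0)%:MP.
Proof. by move=> /pihomog_dE {1}<-; rewrite pihomog0_mcoeff. Qed.

Lemma homog_mcoeff0 d p : p \is d.-homog -> (0 < d)%N -> p@_0 = 0.
Proof. by move=> h d0; rewrite (dhomog_nemf_coeff h) //= mdeg0 eq_sym -lt0n. Qed.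

Lemma proj_homog a v d f : f \is d.-homog -> proj a v f \is d.-homog.
Proof.
move=> /dhomogP hf; rewrite [in X in proj _ _ X](mpolyE f) (raddf_sum (proj a v)) /= big_seq.
apply: rpred_sum => m /hf md; rewrite projZ; apply: rpredZ.
rewrite -md mpolyXE_id rmorph_prod /= mdegE.
elim/big_rec2: _ => [|i y1 y2 _ IH]; first exact: dhomog1.
apply: dhomogM => //; rewrite rmorphXn /= projX.
have H : 'X_i - v 0 i *: lf a \is 1.-homog.
  by apply: rpredB; [rewrite dhomogX /= mdeg1|exact/rpredZ/lf_homog].
by have := dhomogMn (m i) H; rewrite mul1n.
Qed.

(** The component of degree [n - d] of any quotient is again a quotient. As the subtraction is
    truncated, [n < d] needs its own clause. *)
Lemma homog_quotient d n p f : p \is d.-homog -> f \is n.-homog ->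
  dvds p f -> exists h, [/\ f = h * p, h \is (n - d).-homog &
  (n < d)%N -> h = 0].
Proof.
move=> hp /pihomog_dE {2}<- [g ->]; rewrite (pihomogM_homogr _ _ hp).
case: leqP => dn.
  exists (pihomog mdeg (n - d) g); split=> //; exact: pihomogP.
by exists 0; rewrite mul0r; split=> //; apply: dhomog0.
Qed.

(** A substitute for unique factorization: only the factors [F i] have to be prime, and they are
    cancelled one at a time. *)
Lemma dvds_coprime_prod (I : Type) (s : seq I) (F : I -> S) (P : pred I) q f :
  (forall i, P i -> prime_elt (F i) /\ ~ dvds (F i) q) ->
  dvds (\prod_(i <- s | P i) F i) f -> dvds q f ->
  dvds ((\prod_(i <- s | P i) F i) * q) f.
Proof.
move=> h; elim: s f => [|i s IH] f; first by rewrite big_nil mul1r.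
rewrite big_cons; case: ifP => Pi; last exact: IH.
move=> [u fu] [w fw].
have [[i0 hi] hq] := h i Pi.
have : dvds (F i) (w * q).
  by exists (u * \prod_(j <- s | P j) F j); rewrite -fw fu; ring.
case/hi => // -[w' ww'].
have e : u * \prod_(j <- s | P j) F j = w' * q.
  by apply: (mulfI i0); rewrite mulrCA -fu fw ww'; ring.
have [z hz] := IH (w' * q) (ex_intro _ u (esym e)) (ex_intro _ w' erefl).
by exists z; rewrite fw ww' mulrAC hz; ring.
Qed.

End LinearForms.

(** * Too few homogeneous elements cannot cut out the origin *)

Section ParameterCount.

Variables (K : fieldType) (l n N k : nat).
Notation S := {mpoly K[l]}.
Variables (g : 'I_n -> S).

Notation idx := ({ffun 'I_l -> 'I_N} * {ffun 'I_n -> 'I_k})%type.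
Notation wt J := (\sum_j (J : idx).2 j : nat)%N.

Definition genprod (J : idx) : S := (\prod_i 'X_i ^+ J.1 i) * \prod_j g j ^+ J.2 j.

(** The filtration counts the factors [g j], not the degree. As long as [t] stays below [k], the
    exponents remain inside the finite index type. *)
Definition filtspan t f := exists c : idx -> K, f = \sum_(J | (wt J <= t)%N) c J *: genprod J.

Lemma filtspan0 t : filtspan t 0.
Proof. by exists (fun=> 0); rewrite big1 // => J _; rewrite scale0r. Qed.

Lemma filtspanD t f h : filtspan t f -> filtspan t h -> filtspan t (f + h).
Proof.
case=> c -> [d ->]; exists (fun J => c J + d J); rewrite -big_split.
by apply: eq_bigr => J _; rewrite scalerDl.
Qed.

Lemma filtspanZ t (b : K) f : filtspan t f -> filtspan t (b *: f).
Proof.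
case=> c ->; exists (fun J => b * c J); rewrite scaler_sumr.
by apply: eq_bigr => J _; rewrite scalerA.
Qed.

Lemma filtspan_sum t (I : Type) (s : seq I) (P : pred I) (F : I -> S) :
  (forall i, P i -> filtspan t (F i)) -> filtspan t (\sum_(i <- s | P i) F i).
Proof. by move=> h; elim/big_ind: _ => //; [exact: filtspan0|exact: filtspanD]. Qed.

Lemma filtspan_gen t J : (wt J <= t)%N -> filtspan t (genprod J).
Proof.
move=> h; exists (fun J' => (J' == J)%:R); rewrite (bigD1 J) //= eqxx scale1r.
by rewrite big1 ?addr0 // => J' /andP[_ /negPf ->]; rewrite scale0r.
Qed.

Lemma filtspan_mono t t' f : (t <= t')%N -> filtspan t f -> filtspan t' f.
Proof.
move=> tt' [c ->]; apply: filtspan_sum => J h.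
by apply/filtspanZ/filtspan_gen/(leq_trans h).
Qed.

Lemma filtspan_mulg t f j : (t.+1 < k)%N -> filtspan t f -> filtspan t.+1 (f * g j).
Proof.
move=> tk [c ->]; rewrite mulr_suml; apply: filtspan_sum => J h.
rewrite -scalerAl; apply: filtspanZ.
have lt : ((J.2 j).+1 < k)%N.
  apply: leq_ltn_trans tk; rewrite ltnS; apply: leq_trans h.
  by rewrite (bigD1 j) //= leq_addr.
pose J' : idx := (J.1, [ffun j' => if j' == j then Ordinal lt else J.2 j']).
suff -> : genprod J * g j = genprod J'.
  apply: filtspan_gen; rewrite (bigD1 j) //= ffunE eqxx addSn ltnS.
  apply: leq_trans h; rewrite [X in (_ <= X)%N](bigD1 j) //= leq_add2l.
  by apply: eq_leq; apply: eq_bigr => j' /negPf e; rewrite ffunE e.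
rewrite /genprod -mulrA; congr (_ * _).
rewrite (bigD1 j) // [in RHS](bigD1 j) //= ffunE eqxx /= exprSr -!mulrA.
congr (_ * _); rewrite mulrC; congr (_ * _).
by apply: eq_bigr => j' /negPf e; rewrite ffunE e.
Qed.

Variable e : 'I_n -> nat.
Hypotheses (e0 : forall j, (0 < e j)%N) (ge : forall j, g j \is (e j).-homog).
Hypothesis powers : forall i, exists u : 'I_n -> S, 'X_i ^+ N = \sum_j u j * g j.

(** A monomial with an exponent at least [N] is rewritten by [powers]. In its homogeneous component
    the cofactor of [g j] has degree [d - e j], which is smaller than [d]. *)
Lemma filtspan_homog d f : (d < k)%N -> f \is d.-homog -> filtspan d f.
Proof.
elim/ltn_ind: d f => d IH f dk /dhomogP hf.
rewrite (mpolyE f) big_seq; apply: filtspan_sum => m /hf md; apply: filtspanZ.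
case: (boolP [forall i, m i < N]%N) => [/forallP h|].
  have k0 : (0 < k)%N by exact: leq_ltn_trans dk.
  pose J : idx := ([ffun i => Ordinal (h i)], [ffun=> Ordinal k0]).
  suff -> : 'X_[m] = genprod J.
    by apply: filtspan_gen; rewrite big1 // => j _; rewrite ffunE.
  rewrite /genprod mpolyXE_id [X in _ * X]big1 ?mulr1 => [|j _].
    by apply: eq_bigr => i _; rewrite ffunE.
  by rewrite ffunE expr0.
rewrite negb_forall => /existsP[i]; rewrite -leqNgt => Nm.
have [u hu] := powers i.
pose m' := (m - U_(i) *+ N)%MM.
have em : 'X_[m] = 'X_[m'] * 'X_i ^+ N :> S.
  rewrite mpolyXn -mpolyXD submK //; apply/mnm_lepP => i'.
  by rewrite mulmnE mnmE; case: eqP => [<-|_]; rewrite ?mul1n ?mul0n.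
have hm : ('X_[m] : S) \is d.-homog by rewrite dhomogX /= -md.
rewrite -(pihomog_dE hm) em hu mulr_sumr raddf_sum /=; apply: filtspan_sum => j _.
rewrite mulrA (pihomogM_homogr _ _ (ge j)); case: leqP => ed; last exact: filtspan0.
have lt : (d - e j < d)%N by rewrite ltn_subrL e0 (leq_trans (e0 j) ed).
apply: (filtspan_mono lt); apply: filtspan_mulg; first exact: leq_ltn_trans lt dk.
by apply: IH => //; [exact: ltn_trans lt dk|exact: pihomogP].
Qed.

End ParameterCount.

(* Counting monomials: were some power of each variable in the ideal of the
   [g j], the polynomial ring would be a finite module over [K[g_1, ..., g_n]],
   and the dimensions of its graded pieces would grow too slowly. *)
Lemma few_generators (K : fieldType) (l n N : nat) (g : 'I_n -> {mpoly K[l]})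
    (e : 'I_n -> nat) :
  (n < l)%N -> (forall j, 0 < e j)%N -> (forall j, g j \is (e j).-homog) ->
  ~ (forall i, exists u : 'I_n -> {mpoly K[l]}, 'X_i ^+ N = \sum_j u j * g j).
Proof.
move=> nl e0 ge powers.
(* The [q ^ l] monomials with all exponents below [q] have degree less than [k]. They lie in the
   span of [N ^ l * k ^ n] products, and [k <= l.+1 * q]; so [q] only has to exceed
   [N ^ l * l.+1 ^ n]. *)
pose q := (N ^ l * l.+1 ^ n).+1; pose k := (l * q).+1.
pose A := {ffun 'I_l -> 'I_q}.
pose J := ({ffun 'I_l -> 'I_N} * {ffun 'I_n -> 'I_k})%type.
have card : (#|{: J}| < #|{: A}|)%N.
  rewrite /J /A card_prod !card_ffun !card_ord.
  have kq : (k <= l.+1 * q)%N by rewrite /k mulSn -addn1 addnC leq_add2r.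
  have qq : (q ^ n * q <= q ^ l)%N by rewrite -expnSr leq_pexp2l.
  apply: leq_trans qq; apply: (@leq_ltn_trans (N ^ l * (l.+1 * q) ^ n)).
    rewrite leq_mul2l; apply/orP; right.
    by have [->|n0] := posnP n; rewrite ?expn0 ?leq_exp2r.
  by rewrite expnMn mulnA [X in (X < _)%N]mulnC ltn_pmul2l ?expn_gt0.
pose mon (a : A) : 'X_{1..l} := [multinom (a i : nat) | i < l].
have mon_inj : injective mon.
  move=> a b /mnmP h; apply/ffunP => i; apply: val_inj.
  by have := h i; rewrite !mnmE.
have : forall a : A, exists c : {ffun J -> K}, 'X_[mon a] =
    \sum_j c j *: genprod g j.
  move=> a; have lt : (mdeg (mon a) < k)%N.
    rewrite mdegE ltnS -[X in (_ <= X * _)%N]card_ord -sum_nat_const.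
    by apply: leq_sum => i _; rewrite mnmE ltnW.
  have hm : ('X_[mon a] : {mpoly K[l]}) \is (mdeg (mon a)).-homog.
    by rewrite dhomogX.
  have [c hc] := filtspan_homog e0 ge powers lt hm.
  exists [ffun j => if (\sum_i ((j : J).2 i : nat) <= mdeg (mon a))%N then c j else 0].
  rewrite hc big_mkcond; apply: eq_bigr => j _; rewrite ffunE.
  by case: ifP => // _; rewrite scale0r.
case/fin_all_exists => c hc.
(* The monomials outnumber the products spanning them, so the coefficient matrix has a nonzero left
   kernel: a linear relation between distinct monomials. *)
pose C := \matrix_(i < #|{: A}|, j < #|{: J}|) c (enum_val i) (enum_val j).
have : kermx C != 0.
  rewrite -mxrank_eq0 mxrank_ker subn_eq0 -ltnNge.
  exact: leq_ltn_trans (rank_leq_col _) card.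
case/rowV0Pn => u /sub_kermxP uC /negP[]; apply/eqP/rowP => i0; rewrite mxE.
have : \sum_i u 0 i *: 'X_[mon (enum_val i)] = 0 :> {mpoly K[l]}.
  under eq_bigr => i _ do rewrite hc scaler_sumr.
  rewrite exchange_big big1 //= => j _.
  under eq_bigr => i _ do rewrite scalerA.
  rewrite -scaler_suml; suff -> : \sum_i u 0 i * c (enum_val i) j = 0 by rewrite scale0r.
  move/rowP/(_ (enum_rank j)): uC; rewrite !mxE => h; rewrite -[RHS]h.
  by apply: eq_bigr => i _; rewrite mxE enum_rankK.
move/(congr1 (mcoeff (mon (enum_val i0)))); rewrite mcoeff0 raddf_sum (bigD1 i0) //=.
rewrite mcoeffZ mcoeffX eqxx mulr1 big1 ?addr0 // => i ii0.
by rewrite mcoeffZ mcoeffX (inj_eq mon_inj) (inj_eq enum_val_inj) (negPf ii0) mulr0.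
Qed.

(** * Terao's polynomial *)

Section Families.

Variables (K : fieldType) (l : nat) (T : finType) (a : T -> 'rV[K]_l).
Notation S := {mpoly K[l]}.
Implicit Types (E C M : {set T}) (h s t : T) (th : 'rV[S]_l).

Definition spanv C : 'M[K]_l := (\sum_(s in C) <<a s>>)%MS.
(** The closure operator of the matroid of the normals, taken in the whole index type. The
    localization of [E] at the flat of [Z] is [E :&: clos Z]. *)
Definition clos C := [set t | (a t <= spanv C)%MS].

Lemma spanv_subP m C (X : 'M[K]_(m, l)) :
  reflect (forall t, t \in C -> (a t <= X)%MS) (spanv C <= X)%MS.
Proof.
by apply: (iffP sumsmx_subP) => h t /h; rewrite genmxE.
Qed.

Lemma mem_spanv C t : t \in C -> (a t <= spanv C)%MS.
Proof. by apply/spanv_subP. Qed.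

Lemma mem_clos C t : t \in C -> t \in clos C.
Proof. by rewrite inE; apply: mem_spanv. Qed.

Lemma clos_min C C' : C \subset clos C' -> clos C \subset clos C'.
Proof.
move=> /subsetP sub; apply/subsetP => t; rewrite !inE => /submx_trans; apply.
by apply/spanv_subP => s /sub; rewrite inE.
Qed.

Lemma clos2P h t s :
  reflect (exists p q, a s = p *: a h + q *: a t) (s \in clos [set h; t]).
Proof.
rewrite inE; apply: (iffP idP) => [|[p [q ->]]]; last first.
  by rewrite addmx_sub ?scalemx_sub ?mem_spanv // !inE eqxx ?orbT.
have : (spanv [set h; t] <= a h + a t)%MS.
  apply/spanv_subP => t'; rewrite !inE => /orP[] /eqP ->.
    exact: addsmxSl.
  exact: addsmxSr.
move=> sub /submx_trans/(_ sub)/sub_addsmxP[[u1 u2] /= ->].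
by exists (u1 0 0), (u2 0 0); rewrite (mx11_scalar u1) (mx11_scalar u2) !mul_scalar_mx !mxE.
Qed.

Definition nonpar := (forall t, a t != 0) /\
  (forall s t, s != t -> forall c, a s != c *: a t).

(** The value of the derivation [th] on the linear form [lf b]. *)
Definition app th (b : 'rV[K]_l) : S := \sum_i b 0 i *: th 0 i.

Lemma appD th b b' : app th (b + b') = app th b + app th b'.
Proof. by rewrite /app -big_split; apply: eq_bigr => i _; rewrite mxE scalerDl. Qed.

Lemma appZ th c b : app th (c *: b) = c *: app th b.
Proof. by rewrite /app scaler_sumr; apply: eq_bigr => i _; rewrite mxE scalerA. Qed.

Lemma app0 b : app 0 b = 0.
Proof. by rewrite /app big1 // => i _; rewrite mxE scaler0. Qed.

Lemma appDr th th' b : app (th + th') b = app th b + app th' b.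
Proof. by rewrite /app -big_split; apply: eq_bigr => i _; rewrite mxE scalerDr. Qed.

Lemma appZr f th b : app (f *: th) b = f * app th b.
Proof. by rewrite /app mulr_sumr; apply: eq_bigr => i _; rewrite mxE scalerAr. Qed.

Lemma app_sum (I : finType) (P : pred I) (F : I -> 'rV[S]_l) b :
  app (\sum_(i | P i) F i) b = \sum_(i | P i) app (F i) b.
Proof. by elim/big_rec2: _ => [|i y1 y2 _ <-]; rewrite ?app0 ?appDr. Qed.

Definition inD E th := forall t, t \in E -> dvds (lf (a t)) (app th (a t)).

Lemma inD_sub E E' th : E \subset E' -> inD E' th -> inD E th.
Proof. by move=> /subsetP sub h t /sub; apply: h. Qed.

Lemma inDD E th th' : inD E th -> inD E th' -> inD E (th + th').
Proof. by move=> h h' t tE; rewrite appDr; apply: dvds_add; [exact: h|exact: h']. Qed.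

Lemma inDZ E f th : inD E th -> inD E (f *: th).
Proof. by move=> h t tE; rewrite appZr; apply/dvds_mull/h. Qed.

Lemma inD_mulprod E E' th :
  inD E th -> inD (E :|: E') ((\prod_(t in E') lf (a t)) *: th).
Proof.
move=> h t; rewrite appZr inE; case: (boolP (t \in E')) => [tE' _|_].
  by rewrite (bigD1 t) //= -mulrA mulrC; apply/dvds_mull/dvds_refl.
by rewrite orbF => /h; apply: dvds_mull.
Qed.

(* [par E h t] indexes the hyperplanes of [E] with the same intersection with
   the hyperplane [h] as [t]. One representative of each such class is left
   out of [nonreps E h], so that the degree of [tpol E h] is
   [|A'| - |A^H|]. *)
Definition par E h t := E :&: clos [set h; t].
Definition nonreps E h := [set t in E | [pick s in par E h t] != Some t].
Definition tpol E h := \prod_(t in nonreps E h) lf (a t).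

Lemma tpol_homog E h : tpol E h \is #|nonreps E h|.-homog.
Proof.
rewrite /tpol -sum1_card; elim/big_rec2: _ => [|t n p _ IH]; first exact: dhomog1.
by apply: dhomogM => //; apply: lf_homog.
Qed.

Hypothesis np : nonpar.

Lemma par_sym h s t : t != h -> s != h -> s \in clos [set h; t] -> t \in clos [set h; s].
Proof.
move=> th sh /clos2P[p [q e]]; have q0 : q != 0.
  by apply: contraTneq sh => q0; have [_ /(_ s h)] := np;
     case: eqP => // _ /(_ isT p); rewrite e q0 scale0r addr0 eqxx.
apply/clos2P; exists (- (q^-1 * p)), q^-1.
by rewrite e scalerDr !scalerA mulVf // scale1r addrA scaleNr addNr add0r.
Qed.

(** Hence [pick] returns the same representative for all members of a class. *)
Lemma par_eq E h s t : t != h -> s != h -> s \in par E h t -> par E h s = par E h t.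
Proof.
move=> th sh; rewrite inE => /andP[_ st]; congr (_ :&: _).
have c1 := par_sym th sh st.
apply/eqP; rewrite eqEsubset !clos_min //; apply/subsetP => t'; rewrite !inE => /orP[] /eqP ->.
- by have := @mem_clos [set h; s] h; rewrite !inE eqxx => /(_ isT).
- by move: c1; rewrite inE.
- by have := @mem_clos [set h; t] h; rewrite !inE eqxx => /(_ isT).
- by move: st; rewrite inE.
Qed.

Lemma mem_par E h t : t \in E -> t \in par E h t.
Proof. by move=> tE; rewrite inE tE mem_clos // !inE eqxx orbT. Qed.

Lemma par_trace E Z h t : h \in clos Z -> t \in clos Z ->
  par (E :&: clos Z) h t = par E h t.
Proof.
move=> hZ tZ; rewrite /par -setIA; congr (_ :&: _); apply/setIidPr.
by apply: clos_min; apply/subsetP => t'; rewrite in_set2 => /orP[] /eqP ->.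
Qed.

(** A flat through [h] contains with [t] its whole class, and [pick] sees the same set; so Terao's
    polynomial of a localization is a partial product of the global one. *)
Lemma nonreps_trace E Z h : h \in clos Z ->
  nonreps (E :&: clos Z) h = nonreps E h :&: clos Z.
Proof.
move=> hZ; apply/setP => t; rewrite !in_setI !in_set.
case: (boolP (t \in clos Z)) => [tZ|]; last by rewrite inE => /negPf ->; rewrite !andbF.
have := tZ; rewrite inE => ->; rewrite !andbT; congr (_ && _).
by rewrite (par_trace E hZ tZ).
Qed.

Lemma dvds_prod_nonpar M f :
  (forall t, t \in M -> dvds (lf (a t)) f) -> dvds (\prod_(t in M) lf (a t)) f.
Proof.
have [nz nl] := np; move: {-2}#|M| (erefl #|M|) => n; elim: n M => [|n IH] M eM hM.
  by rewrite (cards0_eq (esym eM)) big_set0; exists f; rewrite mulr1.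
have /card_gt0P[t tM] : (0 < #|M|)%N by rewrite -eM.
rewrite (big_setD1 t) //= mulrC; apply: dvds_coprime_prod; last exact: hM.
  move=> s; rewrite !inE => /andP[st sM]; split; first exact/lf_prime/nz.
  move=> /(dvds_lf (nz s))[c /eqP]; apply/negP; apply: nl; by rewrite eq_sym.
apply: IH => [|s]; last by rewrite inE => /andP[_ /hM].
by move: eM; rewrite (cardsD1 t) tM => -[].
Qed.

Lemma proj_lf_neq0 h t v : dotv (a h) v = 1 -> t != h -> a t - dotv (a t) v *: a h != 0.
Proof. by move=> hv th; rewrite subr_eq0; case: np => _; apply. Qed.

Lemma proj_lf_prime h t v : dotv (a h) v = 1 -> t != h ->
  prime_elt (proj (a h) v (lf (a t))).
Proof. by move=> hv th; rewrite proj_lf; apply/lf_prime/proj_lf_neq0. Qed.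

Lemma proj_lf_dvds h s t v : dotv (a h) v = 1 -> t != h ->
  dvds (proj (a h) v (lf (a t))) (proj (a h) v (lf (a s))) -> s \in clos [set h; t].
Proof.
move=> hv th; rewrite !proj_lf => /(dvds_lf (proj_lf_neq0 hv th))[c /eqP].
rewrite subr_eq => /eqP e; apply/clos2P.
exists (dotv (a s) v - c * dotv (a t) v), c.
by rewrite [LHS]e scalerBr scalerBl scalerA addrAC [RHS]addrC addrA.
Qed.

Lemma dvds_rmorph (R : S -> S) p f : {morph R : x y / x * y} -> dvds p f -> dvds (R p) (R f).
Proof. by move=> hR [g ->]; exists (R g); rewrite hR. Qed.

Lemma proj_mul b v : {morph @proj K l b v : x y / x * y}.
Proof. by move=> x y; rewrite rmorphM. Qed.

(** Within a class the restricted forms are proportional, so divisibility by their product must be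
    obtained before restricting. With [g] the quotient of [th] at the representative, the value of
    [th] at [h] minus [g * x] is divisible by the form of every other member, and these forms are
    pairwise nonproportional. *)
Lemma tpol_class E h v th t0 : dotv (a h) v = 1 -> h \notin E -> inD E th -> t0 \in E ->
  dvds (\prod_(t in nonreps E h :&: par E h t0) proj (a h) v (lf (a t)))
       (proj (a h) v (app th (a h))).
Proof.
move=> hv hE hth t0E.
have neh t : t \in E -> t != h by apply: contraTneq => ->.
have [r] : exists r, [pick s in par E h t0] = Some r.
  by case: pickP => [r _|/(_ t0)]; [exists r|rewrite mem_par].
move=> hr; have rp : r \in par E h t0 by move: hr; case: pickP => // r' h' [<-].
have rE : r \in E by move: rp; rewrite inE => /andP[].
have [g hg] := hth _ rE.
set x := lf (a h); set F := app th (a h).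
have : dvds (\prod_(t in nonreps E h :&: par E h t0) lf (a t)) (F - g * x).
  apply: dvds_prod_nonpar => t; rewrite in_setI => /andP[tN tp].
  have tE : t \in E by move: tN; rewrite inE => /andP[].
  have ptr : par E h t = par E h r by rewrite !(@par_eq E h _ t0) ?neh.
  have tr : t != r.
    apply: contraTneq tN => ->; rewrite inE rE /= negbK (par_eq _ _ rp) ?neh //.
    by rewrite hr.
  have : t \in clos [set h; r].
    by move: (mem_par h tE); rewrite ptr inE => /andP[].
  case/clos2P => p [q e].
  have p0 : p != 0.
    by have [_ /(_ t r tr q)] := np; apply: contraNneq => p0; rewrite e p0 scale0r add0r.
  have [g' hg'] := hth _ tE.
  exists (p^-1 *: (g' - g)); rewrite -scalerAl.
  apply: (@scalerI _ _ p p0) => /=; rewrite scalerA divff // scale1r.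
  have : p *: F + q *: (g * lf (a r)) = g' * lf (a t) by rewrite -hg' e appD !appZ -hg.
  move=> E1; have E2 : p *: F = g' * lf (a t) - q *: (g * lf (a r)) by rewrite -E1 addrK.
  rewrite scalerBr E2 e lfD !lfZ -/x -!mul_mpolyC; ring.
move/(dvds_rmorph (@proj_mul (a h) v)).
by rewrite rmorph_prod rmorphB rmorphM /= [proj _ _ x]proj_self // mulr0 subr0.
Qed.

(** Restricted forms from different classes are nonproportional primes, so whole classes are split
    off one after the other. *)
Lemma tpol_dvds E h v th : dotv (a h) v = 1 -> h \notin E -> inD E th ->
  dvds (proj (a h) v (tpol E h)) (proj (a h) v (app th (a h))).
Proof.
move=> hv hE hth; rewrite /tpol rmorph_prod /=.
have neh t : t \in E -> t != h by apply: contraTneq => ->.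
suff H n : forall M, #|M| = n -> M \subset nonreps E h ->
    dvds (\prod_(t in M) proj (a h) v (lf (a t))) (proj (a h) v (app th (a h))).
  exact: (H #|nonreps E h|).
elim/ltn_ind: n => n IH M eM /subsetP sub.
have [M0|/card_gt0P[t0 t0M]] := posnP #|M|.
  by rewrite (cards0_eq M0) big_set0; exists (proj (a h) v (app th (a h))); rewrite mulr1.
have ME t : t \in M -> t \in E by move/sub; rewrite inE => /andP[].
rewrite (big_setID (par E h t0)) /= mulrC; apply: dvds_coprime_prod.
- move=> t; rewrite in_setD => /andP[tp tM]; have th' := neh _ (ME _ tM).
  split; first exact: proj_lf_prime.
  case/(prime_dvds_prod _ (proj_lf_prime hv th')).
    by rewrite proj_lf; apply: lf_not1.
  move=> s; rewrite in_setI => /andP[sM sp] /(proj_lf_dvds hv th') st.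
  move: tp; rewrite -(par_eq _ _ sp) ?neh ?ME //.
  rewrite (@par_eq _ _ s t) ?neh ?ME //; last by rewrite inE ME.
  by rewrite mem_par ?ME.
- apply: (IH _ _ _ erefl); last by apply/subsetP => t; rewrite inE => /andP[_ /sub].
  rewrite -eM (cardsD1 t0 M) t0M add1n ltnS; apply: subset_leq_card.
  apply/subsetP => t; rewrite !in_setD => /andP[tp ->]; rewrite andbT inE.
  by apply: contraNneq tp => ->; rewrite mem_par ?ME.
have := tpol_class hv hE hth (ME _ t0M).
rewrite (big_setID M) /= => -[g ->].
have -> : nonreps E h :&: par E h t0 :&: M = M :&: par E h t0.
  by rewrite setIAC; congr (_ :&: _); apply/setIidPr/subsetP.
by rewrite mulrCA; apply/dvds_mulr/dvds_refl.
Qed.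

End Families.

(** * Unimodular steps and addition *)

Lemma dual_vector (K : fieldType) (l m : nat) (b : 'rV[K]_l) (W : 'M[K]_(m, l)) :
  ~~ (b <= W)%MS ->
  exists v, dotv b v = 1 /\ forall w : 'rV[K]_l, (w <= W)%MS -> dotv w v = 0.
Proof.
rewrite submxE => h; have [j hj] : exists j, (b *m cokermx W) 0 j != 0.
  apply/existsP; apply: contraR h; rewrite negb_exists => /forallP h.
  by apply/eqP/rowP => j; move: (h j); rewrite negbK !mxE => /eqP.
pose u := (col j (cokermx W))^T.
have E (w : 'rV_l) : dotv w u = (w *m cokermx W) 0 j.
  by rewrite mxE; apply: eq_bigr => i _; rewrite !mxE.
exists (((b *m cokermx W) 0 j)^-1 *: u); split; first by rewrite dotvZr E mulVf.
by move=> w; rewrite dotvZr E submxE => /eqP ->; rewrite [X in _ * X]mxE mulr0.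
Qed.

Section Step.

Variables (K : fieldType) (l : nat) (T : finType) (a : T -> 'rV[K]_l).
Notation S := {mpoly K[l]}.
Implicit Types (E C M Z : {set T}) (h s t : T) (th : 'rV[S]_l) (f g : S).

Lemma projK b v f : dotv b v = 1 -> proj b v (proj b v f) = proj b v f.
Proof.
move=> bv; apply/eqP; rewrite eq_sym -subr_eq0 -rmorphB; apply/eqP.
by apply/dvds_proj => //; apply: dvds_subproj.
Qed.

Lemma spanv_lin C b : (b <= spanv a C)%MS -> exists u, b = \sum_(t in C) u t *: a t.
Proof.
case/sub_sumsmxP => u ->.
have : forall t, exists c, u t *m <<a t>>%MS = c *: a t.
  by move=> t; apply/sub_rVP; rewrite (submx_trans (submxMl _ _)) // genmxE.
case/fin_all_exists => c hc; exists c.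
by apply: eq_bigr => t _.
Qed.

Definition cst (v : 'rV[K]_l) : 'rV[S]_l := map_mx (@mpolyC l K) v.

Lemma app_cst v b : app (cst v) b = (dotv b v)%:MP.
Proof.
rewrite /app /dotv rmorph_sum /=; apply: eq_bigr => i _.
by rewrite mxE mpolyCM mul_mpolyC.
Qed.

Definition euler : 'rV[S]_l := \row_i 'X_i.

Lemma app_euler b : app euler b = lf b.
Proof. by apply: eq_bigr => i _; rewrite mxE. Qed.

Lemma inD_euler E : inD a E euler.
Proof. by move=> t _; rewrite app_euler; apply: dvds_refl. Qed.

Lemma app_homog d th b : der_homog d th -> app th b \is d.-homog.
Proof. by move=> h; apply: rpred_sum => i _; apply/rpredZ/h. Qed.

Lemma proj_app b v th c : proj b v (app th c) = app (map_mx (proj b v) th) c.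
Proof.
rewrite /app (raddf_sum (proj b v)) /=.
by apply: eq_bigr => i _; rewrite projZ mxE.
Qed.

(* The condition [I = (1)] on adding the hyperplane [h] to [E]. *)
Definition unimodular E h := exists th, inD a E th /\
  dvds (lf (a h)) (app th (a h) - tpol a E h).

Hypothesis np : nonpar a.

Lemma nonpar_neq0 t : a t != 0. Proof. by case: np. Qed.

(* [f |-> (f - proj f) / lf (a t)] is linear over the forms vanishing at [v]
   and undoes the multiplication by [lf (a t)]; it is applied to the
   coefficients of a derivation. *)
Lemma strip_factor E Z h t P th : E \subset clos a Z -> h \in clos a Z ->
  t \notin clos a Z -> inD a E th ->
  dvds (lf (a h)) (app th (a h) - lf (a t) * P) ->
  exists th', inD a E th' /\ dvds (lf (a h)) (app th' (a h) - P).
Proof.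
move=> /subsetP EZ hZ tZ hth [e he].
have [v [tv sv]] : exists v, dotv (a t) v = 1 /\
    forall w : 'rV[K]_l, (w <= spanv a Z)%MS -> dotv w v = 0.
  by apply: dual_vector; rewrite inE in tZ.
have : forall i, exists q, th 0 i - proj (a t) v (th 0 i) = q * lf (a t).
  by move=> i; have [q ->] := dvds_subproj (a t) v (th 0 i); exists q.
case/fin_all_exists => q hq; pose th' : 'rV[S]_l := \row_i q i.
have E1 c : lf (a t) * app th' c = app th c - proj (a t) v (app th c).
  rewrite proj_app /app -sumrB mulr_sumr; apply: eq_bigr => i _.
  by rewrite !mxE -scalerBr hq mulrC -scalerAl.
have ps s : s \in clos a Z -> proj (a t) v (lf (a s)) = lf (a s).
  by rewrite inE => /sv s0; rewrite proj_lf s0 scale0r subr0.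
have t0 : lf (a t) != 0 by rewrite lf_eq0 nonpar_neq0.
exists th'; split.
  move=> s sE; have [g hg] := hth _ sE; have [k hk] := dvds_subproj (a t) v g.
  exists k; apply: (mulfI t0); rewrite E1 hg rmorphM /= ps ?EZ // -mulrBl hk; ring.
have [k hk] := dvds_subproj (a t) v e.
exists k; apply: (mulfI t0); rewrite mulrBr E1.
have -> : app th (a h) = e * lf (a h) + lf (a t) * P by rewrite -he subrK.
rewrite rmorphD !rmorphM /= proj_self // mul0r addr0 ps //.
have : e = k * lf (a t) + proj (a t) v e by rewrite -hk subrK.
by set e' := proj _ _ e => ->; ring.
Qed.

(** The same derivation serves the localization up to the factors of [tpol a E h] outside the flat;
    these are stripped one at a time. *)
Lemma unimodular_trace E Z h : h \in clos a Z -> unimodular E h ->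
  unimodular (E :&: clos a Z) h.
Proof.
move=> hZ [th [hth hd]].
have hth' : inD a (E :&: clos a Z) th by apply: inD_sub hth; apply: subsetIl.
move: hd; rewrite /tpol (big_setID (clos a Z)) /= -nonreps_trace //.
rewrite -/(tpol a (E :&: clos a Z) h) mulrC.
have : all [pred t | t \notin clos a Z]
    [seq t <- index_enum T | t \in nonreps a E h :\: clos a Z].
  by apply/allP => t; rewrite mem_filter in_setD => /andP[/andP[]].
rewrite -big_filter; elim: {+}[seq _ <- _ | _] th hth' {hth} => [|t r IH] th hth' /=.
  by move=> _; rewrite big_nil mul1r => hd; exists th.
move=> /andP[tZ rZ]; rewrite big_cons -mulrA => hd.
have [th2 [hth2 hd2]] := strip_factor (subsetIr _ _) hZ tZ hth' hd.
exact: IH hth2 rZ hd2.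
Qed.

(** A constant derivation along a vector common to all hyperplanes of [E] takes the form of [h] to
    1. All classes are singletons, so Terao's polynomial is 1 as well. *)
Lemma unimodular_outside E h : h \notin clos a E -> unimodular E h.
Proof.
move=> hE; have [v [hv sv]] : exists v, dotv (a h) v = 1 /\
    forall w : 'rV[K]_l, (w <= spanv a E)%MS -> dotv w v = 0.
  by apply: dual_vector; rewrite inE in hE.
have v0 t : t \in E -> dotv (a t) v = 0 by move=> tE; apply/sv/mem_spanv.
exists (cst v); split.
  by move=> t tE; rewrite app_cst v0 // mpolyC0; apply: dvds0.
rewrite app_cst hv /tpol (_ : nonreps a E h = set0).
  by rewrite big_set0 mpolyC1 subrr; apply: dvds0.
apply/setP => t; rewrite [in LHS]inE in_set0; apply/negbTE; rewrite negb_and negbK.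
case: (boolP (t \in E)) => //= tE; apply/eqP.
case: pickP => [s|/(_ t)]; last by rewrite mem_par.
rewrite inE => /andP[sE /clos2P[p [q e]]].
have p0 : p = 0.
  by have := v0 _ sE; rewrite e dotvDl !dotvZl hv v0 // mulr0 addr0 mulr1.
congr Some; apply/eqP; have [_ nl] := np.
by apply: contraT => /nl/(_ q); rewrite e p0 scale0r add0r eqxx.
Qed.

(** The degrees are recorded index by index because two arrangements will have to share them. *)
Definition free_basis E (d : 'I_l -> nat) (b : 'I_l -> 'rV[S]_l) :=
  is_basis (inD a E) b /\ forall i, der_homog (d i) (b i).

Lemma basis_homog E d b n th : free_basis E d b -> inD a E th -> der_homog n th ->
  exists u : 'I_l -> S, [/\ th = \sum_i u i *: b i,
    forall i, u i \is (n - d i).-homog & forall i, (n < d i)%N -> u i = 0].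
Proof.
move=> [[_ gen _] hb] hth hn; have [u hu] := gen _ hth.
exists (fun i => if (d i <= n)%N then pihomog mdeg (n - d i) (u i) else 0); split.
- apply/rowP => j; rewrite -(pihomog_dE (hn j)) hu !summxE raddf_sum /=.
  apply: eq_bigr => i _; rewrite !mxE (pihomogM_homogr _ _ (hb i j)).
  by case: ifP => // _; rewrite mul0r.
- by move=> i; case: ifP => _; [exact: pihomogP|exact: dhomog0].
- by move=> i; case: leqP.
Qed.

(** * The ideal [I] of an added hyperplane and the addition step *)

Section Pivot.

Variables (E : {set T}) (h : T) (d : 'I_l -> nat) (b : 'I_l -> 'rV[S]_l).
Variable v : 'rV[K]_l.
Hypotheses (hE : h \notin E) (fb : free_basis E d b) (hv : dotv (a h) v = 1).
Notation D := #|nonreps a E h|.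
Notation rho := (proj (a h) v).
Notation x := (lf (a h)).

Lemma tpol_proj_neq0 : rho (tpol a E h) != 0.
Proof.
rewrite /tpol rmorph_prod /=; apply/prodf_neq0 => t tN.
have [] // := proj_lf_prime np hv (_ : t != h).
by apply: contraTneq tN => ->; rewrite inE (negPf hE).
Qed.

(** The [c i] are the generators of [I] besides [x]. They are chosen in the image of [rho], which
    stands for the coordinate ring of the hyperplane. *)
Lemma pivot_coefs : exists c : 'I_l -> S, [/\
  forall i, rho (app (b i) (a h)) = c i * rho (tpol a E h),
  forall i, c i \is (d i - D).-homog,
  forall i, (d i < D)%N -> c i = 0 & forall i, rho (c i) = c i].
Proof.
have [[bD _ _] hb] := fb.
have : forall i, exists c, [/\ rho (app (b i) (a h)) = c * rho (tpol a E h),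
    c \is (d i - D).-homog & (d i < D)%N -> c = 0].
  move=> i; apply: homog_quotient.
  - exact/proj_homog/tpol_homog.
  - exact/proj_homog/app_homog.
  - exact: tpol_dvds.
case/fin_all_exists => c hc; exists c; split=> i; have [h1 h2 h3] := hc i => //.
by apply: (mulIf tpol_proj_neq0); rewrite -h1 -[RHS](projK _ hv) h1 rmorphM /= projK.
Qed.

Variable c : 'I_l -> S.
Hypotheses (hc : forall i, rho (app (b i) (a h)) = c i * rho (tpol a E h))
  (ch : forall i, c i \is (d i - D).-homog) (c0 : forall i, (d i < D)%N -> c i = 0)
  (cK : forall i, rho (c i) = c i).

Lemma app_pivot (u : 'I_l -> S) : rho (app (\sum_i u i *: b i) (a h)) =
  (\sum_i rho (u i) * c i) * rho (tpol a E h).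
Proof.
rewrite app_sum (raddf_sum rho) mulr_suml; apply: eq_bigr => i _ /=.
by rewrite appZr rmorphM /= hc mulrA.
Qed.

Lemma pivot_degree i : (c i)@_0 != 0 -> d i = D.
Proof.
move=> hi; apply/eqP; rewrite eqn_leq; apply/andP; split.
  rewrite -subn_eq0 eqn0Ngt; apply/negP => /(homog_mcoeff0 (ch i)) e0.
  by rewrite e0 eqxx in hi.
by rewrite leqNgt; apply/negP => /c0 e0; rewrite e0 mcoeff0 eqxx in hi.
Qed.

(** The constant term of a combination of the [c i] equal to 1 singles out some [c i] with a nonzero
    constant term; being homogeneous, it has degree 0. *)
Lemma unimodular_pivot : unimodular E h -> exists2 i, d i = D & (c i)@_0 != 0.
Proof.
case=> th [/(let: And3 _ gen _ := fb.1 in gen) [u ->]].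
rewrite (dvds_proj _ hv) rmorphB /= app_pivot => /eqP; rewrite subr_eq0.
rewrite -[X in _ == X]mul1r (inj_eq (mulIf tpol_proj_neq0)) => /eqP e.
have [i hi] : exists i, (c i)@_0 != 0.
  apply/existsP; apply: contraT; rewrite negb_exists => /forallP h0.
  move: e => /(congr1 (mcoeff 0)); rewrite mcoeff1 eqxx raddf_sum big1 /=.
    by move/esym/eqP; rewrite oner_eq0.
  by move=> i _; move: (h0 i); rewrite rmorphM /= negbK => /eqP ->; rewrite mulr0.
by exists i => //; apply: pivot_degree.
Qed.

Lemma pivot_unimodular i : d i = D -> (c i)@_0 != 0 -> unimodular E h.
Proof.
move=> di ci; have [[bD _ _] _] := fb.
have ei : c i = ((c i)@_0)%:MP by apply: homog0_const; have := ch i; rewrite di subnn.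
exists (((c i)@_0)^-1%:MP *: b i); split; first exact: inDZ.
apply/(dvds_proj _ hv); rewrite rmorphB appZr rmorphM /= hc {2}ei.
by rewrite mulrA /proj comp_mpolyC -mpolyCM mulVf // mpolyC1 mul1r subrr.
Qed.

Lemma addition_basis i : d i = D -> (c i)@_0 != 0 ->
  exists b', free_basis (h |: E) (fun j => if j == i then (d j).+1 else d j) b'.
Proof.
move=> di ci; have [[bD gen ind] hb] := fb.
have ei : c i = ((c i)@_0)%:MP by apply: homog0_const; have := ch i; rewrite di subnn.
pose gam k := ((c i)@_0)^-1 *: c k.
have gami : gam i = 1 by rewrite /gam {2}ei -mul_mpolyC -mpolyCM mulVf.
have gamK k : rho (gam k) = gam k by rewrite projZ cK.
have bc k : rho (app (b k) (a h)) = gam k * rho (app (b i) (a h)).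
  rewrite !hc mulrA; congr (_ * _).
  by rewrite [X in _ * X]ei mulrC mul_mpolyC scalerA mulfV // scale1r.
have x0 : x != 0 by rewrite lf_eq0 nonpar_neq0.
have ai0 : rho (app (b i) (a h)) != 0.
  rewrite hc mulf_neq0 ?tpol_proj_neq0 //.
  by apply: contraNneq ci => ->; rewrite mcoeff0.
(* As [c i] is a nonzero constant, subtracting [gam k *: b i] makes [b k] tangent to the new
   hyperplane; [b i] itself has to be multiplied by its form, which raises its degree by one. *)
pose b' k := if k == i then x *: b i else b k - gam k *: b i.
have sumb' u : \sum_k u k *: b' k =
    \sum_(k | k != i) u k *: b k + (u i * x - \sum_(k | k != i) u k * gam k) *: b i.
  rewrite (bigD1 i) //= /b' eqxx scalerA addrC.
  under eq_bigr => k /negPf ki do rewrite ki scalerBr scalerA.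
  rewrite big_split /= sumrN -scaler_suml -addrA; congr (_ + _).
  by rewrite addrC scalerBl.
exists b'; split; last first.
  move=> k j; rewrite /b'; case: (eqVneq k i) => [->|ki].
    by rewrite mxE -[(d i).+1]add1n; apply: dhomogM; [exact: lf_homog|exact: hb].
  rewrite !mxE; apply: rpredB; first exact: hb.
  have [lt|ge] := ltnP (d k) D.
    by rewrite /gam (c0 lt) scaler0 mul0r; apply: dhomog0.
  rewrite -(subnK ge) -di; apply: dhomogM; last exact: hb.
  by rewrite di; apply/rpredZ/ch.
split.
- move=> k t; rewrite in_setU1 => /orP[/eqP ->|tE]; last first.
    rewrite /b'; case: ifP => _; first exact: inDZ (bD i) _ tE.
    by apply: (inDD (bD k)) tE => //; rewrite -scaleNr; apply/inDZ/bD.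
  rewrite /b'; case: ifP => _; first by rewrite appZr; apply/dvds_mulr/dvds_refl.
  apply/(dvds_proj _ hv); rewrite appDr -scaleNr appZr rmorphD rmorphM rmorphN /=.
  by rewrite gamK bc mulNr subrr.
- move=> th hth; have [u hu] : exists u, th = \sum_k u k *: b k.
    by apply: gen; apply: inD_sub hth; apply: subsetUr.
  have : dvds x (\sum_k u k * gam k).
    apply/(dvds_proj _ hv); apply: (mulIf ai0); rewrite mul0r (raddf_sum rho) mulr_suml /=.
    have : dvds x (app th (a h)) by apply: hth; rewrite setU11.
    rewrite (dvds_proj _ hv) hu app_sum (raddf_sum rho) /= => e; rewrite -[RHS]e.
    by apply: eq_bigr => k _; rewrite appZr !rmorphM /= gamK [in RHS]bc mulrA.
  case=> e he; exists (fun k => if k == i then e else u k).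
  have ui : e * x - \sum_(k | k != i) u k * gam k = u i.
    by rewrite -he (bigD1 i) //= gami mulr1 addrK.
  rewrite sumb' eqxx hu (bigD1 i) //= addrC -[in LHS]ui.
  congr (_ + _ *: _); first by apply: eq_bigr => k /negPf ->.
  by congr (_ - _); apply: eq_bigr => k /negPf ->.
- move=> u; rewrite sumb' => e.
  pose w k := if k == i then u i * x - \sum_(k | k != i) u k * gam k else u k.
  have w0 k : w k = 0.
    apply: (ind w) k; rewrite (bigD1 i) //= addrC -[RHS]e /w eqxx; congr (_ + _).
    by apply: eq_bigr => k /negPf ->.
  have uk k : k != i -> u k = 0 by move=> /negPf ki; have := w0 k; rewrite /w ki.
  move=> k; have [->|/uk //] := eqVneq k i.
  have := w0 i; rewrite /w eqxx big1 => [|k' /uk ->]; last by rewrite mul0r.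
  by rewrite subr0 => /eqP; rewrite mulf_eq0 (negPf x0) orbF => /eqP.
Qed.

End Pivot.

End Step.

(** * From local to global *)

(** One of the [l] generators is zero; this lets them be indexed like a basis of derivations. *)
Lemma few_generators0 (K : fieldType) (l N : nat) (g : 'I_l -> {mpoly K[l]})
    (e : 'I_l -> nat) i0 :
  g i0 = 0 -> (forall j, 0 < e j)%N -> (forall j, g j \is (e j).-homog) ->
  ~ (forall i, exists u : 'I_l -> {mpoly K[l]}, 'X_i ^+ N = \sum_j u j * g j).
Proof.
case: l g e i0 => [|l] g e i0; first by case: i0.
move=> gi0 e0 ge powers.
have := few_generators (g := g \o fintype.lift i0) (e := e \o fintype.lift i0) (N := N).
apply=> /= [//|j|j|i]; [exact: e0|exact: ge|].
have [u hu] := powers i; exists (u \o fintype.lift i0).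
by rewrite hu (bigD1_ord i0) //= gi0 mulr0 add0r.
Qed.

(** * Ideals given as predicates, and powers lying in them *)

Section Ideals.

Variables (K : fieldType) (l : nat).
Notation S := {mpoly K[l]}.

Definition is_ideal (J : S -> Prop) := [/\ J 0, forall f g, J f -> J g -> J (f + g) &
  forall f g, J g -> J (f * g)].

Lemma ideal_sum J (I : finType) (P : pred I) (F : I -> S) : is_ideal J ->
  (forall i, P i -> J (F i)) -> J (\sum_(i | P i) F i).
Proof. by case=> J0 JD _ h; elim/big_ind: _. Qed.

Lemma ideal_scale J (c : K) f : is_ideal J -> J f -> J (c *: f).
Proof. by case=> _ _ JM h; rewrite -mul_mpolyC; apply: (JM). Qed.

Definition ideal_gen n (g : 'I_n -> S) f := exists u : 'I_n -> S, f = \sum_j u j * g j.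

Lemma ideal_gen_ideal n (g : 'I_n -> S) : is_ideal (ideal_gen g).
Proof.
split.
- by exists (fun=> 0); rewrite big1 // => j _; rewrite mul0r.
- move=> _ _ [u ->] [w ->]; exists (fun j => u j + w j).
  by rewrite -big_split; apply: eq_bigr => j _; rewrite mulrDl.
- move=> f _ [u ->]; exists (fun j => f * u j).
  by rewrite mulr_sumr; apply: eq_bigr => j _; rewrite mulrA.
Qed.

Lemma mem_ideal_gen n (g : 'I_n -> S) j : ideal_gen g (g j).
Proof.
exists (fun j' => (j' == j)%:R); rewrite (bigD1 j) //= eqxx mul1r big1 ?addr0 //.
by move=> j' /negPf ->; rewrite mul0r.
Qed.

(** Multiplying the congruences leaves only the product of the [F i] outside [J]. *)
Lemma power_prod J f (I : eqType) (s : seq I) (F : I -> S) : is_ideal J ->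
  (forall i, i \in s -> exists n g u, J g /\ f ^+ n = g + u * F i) ->
  exists n g u, J g /\ f ^+ n = g + u * \prod_(i <- s) F i.
Proof.
move=> iJ; have [J0 JD JM] := iJ; elim: s => [_|i s IH h].
  by exists 0%N, 0, 1; split=> //; rewrite big_nil expr0 mulr1 add0r.
have [n [g [u [Jg e]]]] := h i (mem_head _ _).
have [|n' [g' [u' [Jg' e']]]] := IH.
  by move=> i' i's; apply: h; rewrite inE i's orbT.
exists (n + n')%N, (g * g' + (u * F i) * g' + (u' * \prod_(j <- s) F j) * g), (u * u').
split; last by rewrite exprD e e' big_cons; ring.
by apply: (JD); [apply: (JD)|]; apply: (JM).
Qed.

End Ideals.

Section Step.

Variables (K : fieldType) (l : nat) (T : finType) (a : T -> 'rV[K]_l).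
Notation S := {mpoly K[l]}.
Implicit Types (E C M Z : {set T}) (h s t : T) (th : 'rV[S]_l) (f g : S).

Lemma ideal_lf J C b : is_ideal J -> (forall t, t \in C -> J (lf (a t))) ->
  (b <= spanv a C)%MS -> J (lf b).
Proof.
move=> iJ h /spanv_lin[u ->]; rewrite lf_sum; apply: ideal_sum => // t tC.
by rewrite lfZ; apply: ideal_scale => //; apply: h.
Qed.

(* Every prime [P] containing [J] contains all the forms [lf (a t)]: those it
   contains cut out a flat, and unless this is the center, the product of the
   forms not vanishing on it is in [J], hence one more form is in [P]. *)
Lemma radical_power E h J f : is_ideal J -> J (lf (a h)) ->
  (forall C, C \subset E -> ~~ (E \subset clos a (h |: C)) ->
     J (\prod_(t in E :\: clos a (h |: C)) lf (a t))) ->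
  (forall J' : S -> Prop, is_ideal J' -> (forall g, J g -> J' g) ->
     (forall t, t \in E -> J' (lf (a t))) -> J' f) ->
  exists n, J (f ^+ n).
Proof.
move=> iJ Jh Jprod Jf.
(* In place of primes, the ideal is enlarged to [J'], with [C] recording the forms adjoined so far.
   Unless [C] and [h] already span [E], each form outside their flat is adjoined in turn and the
   resulting powers are multiplied. *)
suff H n : forall C (J' : S -> Prop), #|E :\: C| = n -> C \subset E -> is_ideal J' ->
    (forall g, J g -> J' g) -> (forall t, t \in C -> J' (lf (a t))) ->
    exists n, J' (f ^+ n).
  by apply: (H #|E :\: set0| set0) => // [|t]; rewrite ?sub0set // in_set0.
elim/ltn_ind: n => n IH C J' eC CE iJ' JJ' JC.
have JC' t : t \in clos a (h |: C) -> J' (lf (a t)).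
  rewrite inE; apply: ideal_lf => // s; rewrite in_setU1 => /orP[/eqP ->|]; last exact: JC.
  exact: JJ'.
case: (boolP (E \subset clos a (h |: C))) => [/subsetP sub|nsub].
  by exists 1%N; rewrite expr1; apply: Jf => // t /sub; apply: JC'.
have [J0 JD JM] := iJ'.
have [|n' [g [u [Jg e]]]] := @power_prod _ _ J' f _
   [seq t <- index_enum T | t \in E :\: clos a (h |: C)] (fun t => lf (a t)) iJ'.
  move=> s; rewrite mem_filter => /andP[]; rewrite in_setD => /andP[sC sE] _.
  pose J2 f := exists g u, J' g /\ f = g + u * lf (a s).
  have sC' : s \notin C.
    by apply: contraNN sC => sC; apply/mem_clos; rewrite in_setU1 sC orbT.
  have [||||t|n' [g [u [Jg e]]]] := IH _ _ (s |: C) J2 erefl.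
  - rewrite -eC (cardsD1 s (E :\: C)) in_setD sC' sE add1n ltnS subset_leq_card //.
    by apply/subsetP => t; rewrite !inE negb_or -andbA.
  - by rewrite subUset sub1set sE.
  - split.
    + by exists 0, 0; rewrite mul0r addr0.
    + move=> _ _ [g1 [u1 [h1 ->]]] [g2 [u2 [h2 ->]]]; exists (g1 + g2), (u1 + u2).
      by split; [exact: JD|ring].
    + move=> k _ [g1 [u1 [h1 ->]]]; exists (k * g1), (k * u1).
      by split; [exact: JM|ring].
  - by move=> g Jg; exists g, 0; rewrite mul0r addr0; split=> //; apply: JJ'.
  - rewrite in_setU1 => /orP[/eqP ->|tC].
      by exists 0, 1; rewrite mul1r add0r.
    by exists (lf (a t)), 0; rewrite mul0r addr0; split=> //; apply: JC.
  by exists n', g, u.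
exists n'; rewrite e; apply: (JD) => //; apply: (JM); apply: JJ'.
by rewrite big_filter; apply: Jprod.
Qed.

Lemma free_basis_swap E d b i j : d i = d j -> free_basis a E d b ->
  free_basis a E d (b \o tperm i j).
Proof.
move=> dij [[bD gen ind] hb]; split; last first.
  move=> k; rewrite /comp; case: tpermP => [->|->|_ _]; rewrite ?dij; last exact: hb.
    exact: hb.
  by rewrite -dij; apply: hb.
have R u : \sum_k u k *: (b \o tperm i j) k = \sum_k (u \o tperm i j) k *: b k.
  rewrite (reindex_inj (@perm_inj _ (tperm i j))) /=.
  by apply: eq_bigr => k _; rewrite tpermK.
split=> [k|th /gen[u ->]|u]; first exact: bD.
  exists (u \o tperm i j); rewrite R; apply: eq_bigr => k _.
  by rewrite /= tpermK.
by rewrite R => /ind e k; have := e (tperm i j k); rewrite /= tpermK.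
Qed.

Hypothesis np : nonpar a.

Definition bump_at (d : 'I_l -> nat) i := fun j => if j == i then (d j).+1 else d j.

(** The pivot depends on the arrangement, but any element of the same degree can be swapped into its
    place. Two arrangements with equal degrees can therefore raise the same index. *)
Lemma addition E h d b : h \notin E -> free_basis a E d b -> unimodular a E h ->
  (exists i, d i = #|nonreps a E h|) /\
  (forall i, d i = #|nonreps a E h| -> exists b', free_basis a (h |: E) (bump_at d i) b').
Proof.
move=> hE fb U; have [v hv] := dotv_ex (nonpar_neq0 np h).
have [c [h1 h2 h3 h4]] := pivot_coefs np hE fb hv.
have [i di ci] := unimodular_pivot np hE fb hv h1 h2 h3 U.
split; first by exists i.
move=> j dj; have dij : d j = d i by rewrite di.
have fb2 := free_basis_swap dij fb.
apply: (addition_basis np hE fb2 hv (c := c \o tperm j i)) => //=.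
- move=> k; case: tpermP => [->|->|_ _]; [rewrite dij|rewrite -dij|]; exact: h2.
- move=> k; case: tpermP => [->|->|_ _]; [rewrite dij|rewrite -dij|]; exact: h3.
- by rewrite tpermL.
Qed.

(** The value is a constant, and a constant divisible by a linear form is zero. *)
Lemma degree0_kill E d b i t : free_basis a E d b -> d i = 0%N -> t \in clos a E ->
  app (b i) (a t) = 0.
Proof.
move=> [[bD _ _] hb] di; rewrite inE => /spanv_lin[u ->].
elim/big_rec: _ => [|s w sE IH].
  by rewrite /app big1 // => j _; rewrite mxE scale0r.
rewrite appD appZ IH addr0; have [g hg] := bD i s sE.
have := app_homog (a s) (hb i); rewrite di => /pihomog_dE <-.
by rewrite hg (pihomogM_homogr _ _ (lf_homog (a s))) scaler0.
Qed.

Section Euler.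

Variables (E : {set T}) (d : 'I_l -> nat) (b : 'I_l -> 'rV[S]_l) (u : 'I_l -> S).
Hypotheses (fb : free_basis a E d b) (eu : euler K l = \sum_i u i *: b i)
  (uh : forall i, u i \is (1 - d i).-homog) (u0 : forall i, (1 < d i)%N -> u i = 0).

Lemma euler_coef t : t \in E -> exists2 i, d i = 1%N & (u i)@_0 != 0.
Proof.
move=> tE; suff /exists_inP[i /eqP] : [exists (i | d i == 1%N), (u i)@_0 != 0] by exists i.
apply: contraT; rewrite negb_exists_in => /forall_inP h0.
have : lf (a t) = 0.
  rewrite -app_euler eu app_sum big1 // => i _; rewrite appZr.
  have [di|] := posnP (d i).
    by rewrite (degree0_kill fb di) ?mulr0 ?mem_clos.
  rewrite leq_eqVlt eq_sym => /orP[/eqP di|/u0 ->]; last by rewrite mul0r.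
  have := uh i; rewrite di => /homog0_const ->.
  by have := h0 i; rewrite di eqxx => /(_ isT); rewrite negbK => /eqP ->; rewrite mpolyC0 mul0r.
by move/eqP; rewrite lf_eq0 (negPf (nonpar_neq0 np t)).
Qed.

End Euler.

Section Essential.

Variables (E : {set T}) (h : T) (d : 'I_l -> nat) (b : 'I_l -> 'rV[S]_l).
Hypotheses (hE : h \notin E) (hsp : h \in clos a E) (fb : free_basis a E d b).
Notation D := #|nonreps a E h|.

Lemma euler_ex : exists u : 'I_l -> S, [/\ euler K l = \sum_i u i *: b i,
  forall i, u i \is (1 - d i).-homog & forall i, (1 < d i)%N -> u i = 0].
Proof.
apply: (basis_homog fb); first exact: inD_euler.
by move=> i; rewrite mxE dhomogX /= mdeg1.
Qed.

Lemma nonempty_of_clos : exists t, t \in E.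
Proof.
apply/set0Pn; apply: contraTneq hsp => ->; rewrite inE; apply/negP => /spanv_lin[u].
by rewrite big_set0 => /eqP; rewrite (negPf (nonpar_neq0 np h)).
Qed.

Lemma euler_relation v c u : dotv (a h) v = 1 ->
  (forall i, proj (a h) v (app (b i) (a h)) = c i * proj (a h) v (tpol a E h)) ->
  euler K l = \sum_i u i *: b i -> \sum_i proj (a h) v (u i) * c i = 0.
Proof.
move=> hv hc eu; apply: (mulIf (tpol_proj_neq0 np hE hv)).
by rewrite mul0r -(app_pivot hc) -eu app_euler proj_self.
Qed.

(** The pivot has degree [D], and the Euler derivation involves an element of degree 1 with a
    constant coefficient. If they coincide, the nonzero constant they contribute to [euler_relation]
    must be cancelled by another element of degree 1. *)
Lemma unimodular_degrees : unimodular a E h ->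
  (0 < D)%N /\ exists i0 i1, [/\ i0 != i1, d i0 = D & d i1 = 1%N].
Proof.
move=> U; have [v hv] := dotv_ex (nonpar_neq0 np h).
have [c [h1 h2 h3 h4]] := pivot_coefs np hE fb hv.
have [i di ci] := unimodular_pivot np hE fb hv h1 h2 h3 U.
have D0 : (0 < D)%N.
  rewrite lt0n; apply: contraNneq ci => d0; rewrite d0 in di.
  have : c i * proj (a h) v (tpol a E h) = 0.
    by rewrite -h1 (degree0_kill fb di) // rmorph0.
  move/eqP; rewrite mulf_eq0 (negPf (tpol_proj_neq0 np hE hv)) orbF => /eqP ->.
  by rewrite mcoeff0.
split=> //; exists i.
have [u [eu uh u0]] := euler_ex; have [t tE] := nonempty_of_clos.
have [k dk uk] := euler_coef fb eu uh u0 tE.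
have [ki|ki] := eqVneq k i; last by exists k; rewrite eq_sym.
rewrite {}ki in dk uk.
suff /exists_inP[j /andP[ij uj] dj] :
    [exists (j | (i != j) && ((u j)@_0 != 0)), d j == 1%N].
  by exists j; split=> //; apply/eqP.
apply: contraT; rewrite negb_exists_in => /forall_inP hj.
have := euler_relation hv h1 eu; rewrite (bigD1 i) //= big1 => [|j ji].
  rewrite addr0 => /(congr1 (mcoeff 0)); rewrite mcoeff0 rmorphM /=.
  have := uh i; rewrite dk => /homog0_const ->; rewrite /proj comp_mpolyC mcoeffC eqxx mulr1.
  by move/eqP; rewrite mulf_eq0 (negPf uk) (negPf ci).
have [dj|] := posnP (d j); first by rewrite h3 ?dj ?mulr0.
rewrite leq_eqVlt eq_sym => /orP[/eqP dj|/u0 ->]; last by rewrite rmorph0 mul0r.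
suff -> : u j = 0 by rewrite rmorph0 mul0r.
have := uh j; rewrite dj => /homog0_const ->.
have := hj j; rewrite eq_sym ji dj eqxx /=; case: eqP => [->|_ /(_ isT) //].
by rewrite mpolyC0.
Qed.

(** The basis elements of degree 0 span the constant derivations along the center of [E]. The
    pseudo-inverse of the matrix [V0] of their coefficients provides forms that complete the span of
    [E] to the whole dual space. *)
Lemma dual_forms : exists lam : 'I_l -> 'rV[K]_l, forall w : 'rV[K]_l,
  exists k : 'I_l -> K, (w - \sum_(j | d j == 0%N) k j *: lam j <= spanv a E)%MS.
Proof.
pose V0 : 'M[K]_l := \matrix_(j, i) if d j == 0%N then (b j 0 i)@_0 else 0.
pose L := pinvmx V0; exists (fun j => (col j L)^T) => w.
pose k j := (V0 *m w^T) j 0; exists k.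
have k0 j : d j != 0%N -> k j = 0.
  by move=> /negPf dj; rewrite /k mxE big1 // => i _; rewrite mxE dj mul0r.
have ek : (\sum_(j | d j == 0%N) k j *: (col j L)^T)^T = L *m (V0 *m w^T).
  apply/colP => i; rewrite mxE summxE [RHS]mxE big_mkcond /=.
  apply: eq_bigr => j _; rewrite -/(k j); case: eqP => [_|/eqP/k0 ->].
    by rewrite !mxE mulrC.
  by rewrite mulr0.
set w' := w - _; have V0w : V0 *m w'^T = 0.
  by rewrite /w' linearB /= ek mulmxBr (mulmxA V0) (mulmxA (V0 *m L)) mulmxKpV ?subrr.
apply: contraT => /dual_vector[v [wv Ev]].
have hv : inD a E (cst v).
  by move=> t tE; rewrite app_cst Ev ?mem_spanv // mpolyC0; apply: dvds0.
have hom : der_homog 0 (cst v).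
  by move=> i; rewrite mxE -[_%:MP]mulr1 mul_mpolyC; apply/rpredZ/dhomog1.
have [u [eu uh u0]] := basis_homog fb hv hom.
have ev : v = (\row_j (u j)@_0) *m V0.
  apply/rowP => i; have /(congr1 (mcoeff 0)) := congr1 (fun M : 'rV[S]_l => M 0 i) eu.
  rewrite mxE mcoeffC eqxx mulr1 => ->; rewrite summxE raddf_sum [RHS]mxE /=.
  apply: eq_bigr => j _; rewrite !mxE rmorphM /=.
  by case: eqP => // /eqP; rewrite -lt0n => /u0 ->; rewrite mcoeff0 !mul0r.
have : w' *m v^T = 0.
  by rewrite -[LHS]trmxK trmx_mul trmxK ev -mulmxA V0w mulmx0 trmx0.
by rewrite dotv_mx wv => /matrixP/(_ 0 0)/eqP; rewrite !mxE eqxx oner_eq0.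
Qed.

(** Multiplied by the forms of [E] outside the flat, a derivation of the localization lies in
    [D(E)]. Multiplying also by the missing factors [B2] of Terao's polynomial shows that the
    product of those forms lies in [I]. *)
Lemma local_product v c Z : dotv (a h) v = 1 ->
  (forall i, proj (a h) v (app (b i) (a h)) = c i * proj (a h) v (tpol a E h)) ->
  h \in clos a Z -> unimodular a (E :&: clos a Z) h ->
  exists w : 'I_l -> S, proj (a h) v (\prod_(t in E :\: clos a Z) lf (a t)) =
    \sum_i w i * c i.
Proof.
move=> hv hc hZ [th [hth hd]].
pose B2 := \prod_(t in nonreps a E h :\: clos a Z) lf (a t).
set P := \prod_(t in _) _.
have : inD a E (B2 *: (P *: th)).
  apply: inDZ; apply: (inD_sub (E' := E :&: clos a Z :|: (E :\: clos a Z))).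
    by rewrite setID.
  exact: inD_mulprod.
case: fb => -[_ gen _] _ /gen[u eu]; exists (fun i => proj (a h) v (u i)).
apply: (mulIf (tpol_proj_neq0 np hE hv)); rewrite -(app_pivot hc) -eu !appZr.
have -> : tpol a E h = tpol a (E :&: clos a Z) h * B2.
  by rewrite /tpol (big_setID (clos a Z)) /= nonreps_trace.
move: hd; rewrite (dvds_proj _ hv) rmorphB => /eqP; rewrite subr_eq0 => /eqP /= e.
by rewrite !rmorphM /= e; ring.
Qed.

Lemma unimodular_of_local i0 i1 :
  (forall Z, Z \subset h |: E -> h \in clos a Z -> ~~ (E \subset clos a Z) ->
     unimodular a (E :&: clos a Z) h) ->
  (0 < D)%N -> i0 != i1 -> d i0 = D -> d i1 = 1%N -> unimodular a E h.
Proof.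
move=> loc D0 i01 di0 di1; have [v hv] := dotv_ex (nonpar_neq0 np h).
have [c [h1 h2 h3 h4]] := pivot_coefs np hE fb hv.
case: (boolP [exists i, (d i == D) && ((c i)@_0 != 0)]) => [/existsP[i /andP[/eqP di ci]]|].
  exact: (pivot_unimodular fb hv h1 h2 di ci).
rewrite negb_exists => /forallP cD; exfalso.
have c0 i : (d i <= D)%N -> c i = 0.
  rewrite leq_eqVlt => /orP[/eqP di|/h3 //].
  have := h2 i; rewrite di subnn => /homog0_const ->; have := cD i.
  by rewrite di eqxx negbK => /eqP ->; rewrite mpolyC0.
have [u [eu uh u0]] := euler_ex; have [t0 t0E] := nonempty_of_clos.
have [k1 dk1 uk1] := euler_coef fb eu uh u0 t0E.
(* If the Euler index [k1] is [i0], then [D] is 1 and [i1] takes over. *)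
have [k0 k01 dk0] : exists2 k0, k0 != k1 & d k0 = D.
  have [e|ne] := eqVneq i0 k1; last by exists i0.
  by exists i1; rewrite -?e 1?eq_sym // -di0 e dk1.
have [lam hlam] := dual_forms.
(* One generator per basis element: [x] at the Euler index, zero at [k0], the dual forms of the
   center in degree 0, and [c j] elsewhere. In [e], the [maxn 1] only affects zero generators. *)
pose g j := if j == k1 then lf (a h) else if j == k0 then 0 else
  if d j == 0%N then lf (lam j) else c j.
pose e j := if (j == k1) || (d j == 0%N) then 1%N else maxn 1 (d j - D).
have iG := ideal_gen_ideal g; have [G0 GD GM] := iG.
have Gh : ideal_gen g (lf (a h)) by have := mem_ideal_gen g k1; rewrite {2}/g eqxx.
have Gc_ k : k != k1 -> ideal_gen g (c k).
  move=> kk1; have := mem_ideal_gen g k; rewrite {2}/g (negPf kk1).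
  case: (eqVneq k k0) => [->|_]; first by rewrite c0 ?dk0.
  by case: eqP => // dk _; rewrite c0 ?dk.
(* The value left out at [k1] is recovered from the Euler relation, its coefficient there being a
   nonzero constant. *)
have Gc k : ideal_gen g (c k).
  have [->|/Gc_ //] := eqVneq k k1.
  have := euler_relation hv h1 eu; rewrite (bigD1 k1) //=.
  have := uh k1; rewrite dk1 => /homog0_const ->; rewrite {1}/proj comp_mpolyC mul_mpolyC.
  move/eqP; rewrite addr_eq0 => /eqP ck1.
  rewrite -[c k1]scale1r -(mulVf uk1) -scalerA ck1; apply: ideal_scale => //.
  rewrite -mulN1r; apply: (GM); apply: ideal_sum => // k2 kk1.
  by apply: (GM); apply: Gc_.
have Glam j : d j = 0%N -> ideal_gen g (lf (lam j)).
  move=> dj; have := mem_ideal_gen g j; rewrite {2}/g dj eqxx.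
  have -> : j == k1 = false by apply: contra_eqF dj => /eqP ->; rewrite dk1.
  suff -> : j == k0 = false by [].
  by apply: contra_eqF dj => /eqP ->; rewrite dk0 -lt0n.
have pow i : exists n, ideal_gen g ('X_i ^+ n).
  apply: (radical_power iG Gh (E := E)) => [C CE nsub|J' iJ' GJ' JE].
    have hC : h \in clos a (h |: C) by rewrite mem_clos ?setU11.
    have [|w hw] := local_product hv h1 hC; first by apply: loc => //; apply: setUS.
    set P := \prod_(t in _) _ in hw *.
    have [q hq] := dvds_subproj (a h) v P.
    rewrite -[P](subrK (proj (a h) v P)) hq hw; apply: (GD); first exact: GM.
    by apply: ideal_sum => // j _; apply: (GM).
  have [k hk] := hlam (delta_mx 0 i); have [J0 JD JM] := iJ'.
  rewrite -lf_delta -[delta_mx 0 i](subrK (\sum_(j | d j == 0%N) k j *: lam j)) lfD.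
  apply: (JD); first exact: ideal_lf hk.
  rewrite lf_sum; apply: ideal_sum => // j /eqP dj; rewrite lfZ.
  by apply: ideal_scale => //; apply/GJ'/Glam.
have [N hN] := fin_all_exists pow.
apply: (@few_generators0 K l (\sum_i N i) g e k0).
- by rewrite /g (negPf k01) eqxx.
- by move=> j; rewrite /e; case: ifP => // _; rewrite leq_maxl.
- move=> j; rewrite /g /e; case: (eqVneq j k1) => _; first exact: lf_homog.
  case: (eqVneq j k0) => _; first exact: dhomog0.
  case: eqP => _; first exact: lf_homog.
  have [/c0 ->|lt] := leqP (d j) D; first exact: dhomog0.
  by rewrite (maxn_idPr _) ?subn_gt0.
move=> i; rewrite (bigD1 i) //= addnC exprD; exact: GM (hN i).
Qed.

End Essential.

End Step.

(** * A free step is unimodular *)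

Section Deletion.

Variables (K : fieldType) (l : nat) (T : finType) (a : T -> 'rV[K]_l).
Notation S := {mpoly K[l]}.
Implicit Types (C M Z : {set T}) (s t : T) (th : 'rV[S]_l) (f g : S).

(** The derivative of [f] at the origin in the direction [v], that is, its linear part evaluated at
    [v]. *)
Definition dirlin (v : 'rV[K]_l) f : K := \sum_k v 0 k * (f^`M(k))@_0.

Lemma dirlinM v f g : dirlin v (f * g) = dirlin v f * g@_0 + f@_0 * dirlin v g.
Proof.
rewrite /dirlin mulr_suml mulr_sumr -big_split; apply: eq_bigr => k _ /=.
by rewrite mderivM mcoeffD !rmorphM /=; ring.
Qed.

Lemma dirlin_sum v (I : finType) (F : I -> S) :
  dirlin v (\sum_i F i) = \sum_i dirlin v (F i).
Proof.
rewrite /dirlin exchange_big; apply: eq_bigr => k _ /=.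
by rewrite -mulr_sumr; congr (_ * _); rewrite (linear_sum (mderiv k)) /= raddf_sum.
Qed.

Lemma mderiv_lf (b : 'rV[K]_l) k : (lf b)^`M(k) = (b 0 k)%:MP.
Proof.
rewrite /lf (linear_sum (mderiv k)) (bigD1 k) //= big1 ?addr0 => [|i ik].
  rewrite mderivZ mderivX mnmE eqxx (_ : (U_(k) - U_(k))%MM = 0%MM).
    by rewrite mpolyX0 /= scale1r -mul_mpolyC mulr1.
  by apply/mnmP => j; rewrite mnmBE mnm0E subnn.
by rewrite mderivZ mderivX mnmE (negPf ik) /= scale0r scaler0.
Qed.

Lemma dirlin_lf v b : dirlin v (lf b) = dotv b v.
Proof.
by apply: eq_bigr => k _; rewrite mderiv_lf mcoeffC eqxx mulr1 mulrC.
Qed.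

Lemma dirlin0 v : dirlin v 0 = 0.
Proof. by rewrite -[X in dirlin v X](lf0 K l) dirlin_lf /dotv big1 // => i _; rewrite mxE mul0r. Qed.

Lemma lf_mcoeff0 (b : 'rV[K]_l) : (lf b)@_0 = 0.
Proof. exact: homog_mcoeff0 (lf_homog b) _. Qed.

Lemma proj_mcoeff0 b v f : (proj b v f)@_0 = f@_0.
Proof.
have [q hq] := dvds_subproj b v f.
by apply/esym/eqP; rewrite -subr_eq0 -mcoeffB hq rmorphM /= lf_mcoeff0 mulr0.
Qed.

Hypothesis np : nonpar a.

Variables (E : {set T}) (h : T) (d : 'I_l -> nat) (b : 'I_l -> 'rV[S]_l).
Variables (n : nat) (phi : 'I_n -> 'rV[S]_l) (v : 'rV[K]_l).
Hypotheses (hE : h \notin E) (fb : free_basis a E d b)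
  (hphi : is_basis (inD a (h |: E)) phi) (hv : dotv (a h) v = 1).
Notation x := (lf (a h)).
Notation rho := (proj (a h) v).
Notation beta k := (rho (app (b k) (a h))).

Lemma basis_uniq m (e : 'I_m -> 'rV[S]_l) P (u w : 'I_m -> S) : is_basis P e ->
  \sum_i u i *: e i = \sum_i w i *: e i -> forall i, u i = w i.
Proof.
case=> _ _ ind eq i; apply/eqP; rewrite -subr_eq0; apply/eqP.
apply: (ind (fun i => u i - w i)).
by under eq_bigr => j _ do rewrite scalerBl; rewrite sumrB eq subrr.
Qed.

Lemma inD_insert th : inD a E th -> rho (app th (a h)) = 0 -> inD a (h |: E) th.
Proof.
move=> hth h0 t; rewrite in_setU1 => /orP[/eqP ->|]; last exact: hth.
exact/(dvds_proj _ hv).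
Qed.

Lemma app_insert th : inD a (h |: E) th -> rho (app th (a h)) = 0.
Proof. by move=> hth; apply/(dvds_proj _ hv)/hth; rewrite setU11. Qed.

(* [phi = M b] and [x b = N phi], so [N M = x]. The constant terms of [N] form
   a matrix of rank at most one, and the linear part of [N M = x] shows that
   the constant terms of [M] have corank at most one. *)
Lemma transition : exists (M : 'I_n -> 'I_l -> S) (N : 'I_l -> 'I_n -> S),
  [/\ forall j, phi j = \sum_i M j i *: b i,
      forall i, x *: b i = \sum_j N i j *: phi j &
      forall i k, \sum_j N i j * M j k = (i == k)%:R * x].
Proof.
have [[bD bgen bind] _] := fb; have [pD pgen pind] := hphi.
have : forall j, exists m : 'I_l -> S, phi j = \sum_i m i *: b i.
  by move=> j; apply/bgen/(inD_sub _ (pD j))/subsetUr.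
case/fin_all_exists => M hM.
have : forall i, exists m : 'I_n -> S, x *: b i = \sum_j m j *: phi j.
  move=> i; apply/pgen/inD_insert; first exact: inDZ.
  by rewrite appZr rmorphM /= proj_self // mul0r.
case/fin_all_exists => N hN; exists M, N; split=> // i.
apply: (basis_uniq fb.1).
transitivity (\sum_j N i j *: phi j).
  under eq_bigr => k _ do rewrite scaler_suml.
  rewrite exchange_big; apply: eq_bigr => j _ /=; rewrite hM scaler_sumr.
  by apply: eq_bigr => k _; rewrite scalerA.
rewrite -hN (bigD1 i) //= eqxx mul1r big1 ?addr0 // => k ki.
by rewrite eq_sym (negPf ki) mul0r scale0r.
Qed.

(** Modulo [x] the rows of [N] are proportional to the [beta i], because eliminating the value at
    [h] between [b i] and [b i'] gives an element of [D(h |: E)]. A nonzero minor would force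
    [beta i' = 0]; then [b i'] itself is in that module and the row [N i'] is divisible by [x]. *)
Lemma transition_minors (N : 'I_l -> 'I_n -> S) :
  (forall i, x *: b i = \sum_j N i j *: phi j) ->
  forall i i' j j', (N i j)@_0 * (N i' j')@_0 = (N i j')@_0 * (N i' j)@_0.
Proof.
have [[bD bgen bind] _] := fb; have [pD pgen pind] := hphi.
move=> hN i i' j j'.
have R k : beta i' * rho (N i k) = beta i * rho (N i' k).
  have [|e he] := pgen (app (b i') (a h) *: b i - app (b i) (a h) *: b i').
    apply: inD_insert; first by rewrite -scaleNr; apply: inDD; apply: inDZ.
    by rewrite appDr -scaleNr !appZr mulNr [X in _ - X]mulrC subrr rmorph0.
  have : app (b i') (a h) * N i k - app (b i) (a h) * N i' k = x * e k.
    apply: (basis_uniq (u := fun k => app (b i') (a h) * N i k - app (b i) (a h) * N i' k)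
      (w := fun k => x * e k) hphi).
    transitivity (x *: (app (b i') (a h) *: b i - app (b i) (a h) *: b i')).
      rewrite scalerBr !scalerA ![x * _]mulrC -!scalerA !hN !scaler_sumr -sumrB.
      by apply: eq_bigr => m _; rewrite !scalerA scalerBl.
    by rewrite he scaler_sumr; apply: eq_bigr => m _; rewrite scalerA.
  move/(congr1 rho); rewrite rmorphB !rmorphM /= proj_self // mul0r => /eqP.
  by rewrite subr_eq0 => /eqP.
apply/eqP; apply: contraT => minor0.
have b0 : beta i' = 0.
  have : beta i' * rho (N i j * N i' j' - N i j' * N i' j) = 0.
    by rewrite rmorphB !rmorphM /= mulrBr !mulrA !R; ring.
  move/eqP; rewrite mulf_eq0 => /orP[/eqP //|/eqP/(congr1 (mcoeff 0))].
  rewrite proj_mcoeff0 mcoeffB !rmorphM /= mcoeff0 => /eqP.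
  by rewrite subr_eq0 (negPf minor0).
have [|w hw] := pgen (b i'); first exact: inD_insert.
have N0 k : (N i' k)@_0 = 0.
  have -> : N i' k = x * w k.
    apply: (basis_uniq (u := N i') (w := fun k => x * w k) hphi).
    by rewrite -hN {1}hw scaler_sumr; apply: eq_bigr => m _; rewrite scalerA.
  by rewrite rmorphM /= lf_mcoeff0 mul0r.
by move: minor0; rewrite !N0 !mulr0 eqxx.
Qed.

(** The rows of [M] are relations between the [beta m], since each [phi j] is tangent to [h]. Modulo
    the maximal ideal these relations leave at most one generator. *)
Lemma pivot_relations : exists i0, forall k, k != i0 -> exists F : 'I_l -> S,
  [/\ \sum_m F m * beta m = 0, (F k)@_0 != 0 &
      forall m, m != k -> m != i0 -> (F m)@_0 = 0].
Proof.
have [M [N [hM hN hNM]]] := transition.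
have lin (u : 'I_l -> K) : (forall j, \sum_i u i * (N i j)@_0 = 0) ->
    exists F : 'I_l -> S, \sum_m F m * beta m = 0 /\ forall m, (F m)@_0 = u m.
  (* Differentiating [N M = x] along [v] at the origin: [u] annihilates the constant terms of [N],
     so this combination of the rows of [M] has constant terms [u]. *)
  move=> hu; pose w j := \sum_i u i * dirlin v (N i j).
  exists (fun m => rho (\sum_j w j *: M j m)); split.
    transitivity (rho (app (\sum_j (w j)%:MP *: phi j) (a h))).
      rewrite app_sum (raddf_sum rho) /=.
      under [RHS]eq_bigr => j _.
        rewrite appZr hM app_sum rmorphM /= (raddf_sum rho) /= mulr_sumr.
        under eq_bigr => i _ do rewrite appZr rmorphM /= mulrA.
        over.
      rewrite exchange_big; apply: eq_bigr => m _ /=; rewrite -mulr_suml.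
      congr (_ * _); rewrite (raddf_sum rho); apply: eq_bigr => j _ /=.
      by rewrite -mul_mpolyC rmorphM.
    rewrite app_sum (raddf_sum rho) big1 // => j _ /=.
    rewrite appZr rmorphM /= app_insert ?mulr0 //.
    by case: hphi => pD _ _; apply: pD.
  move=> m; rewrite proj_mcoeff0 raddf_sum /=.
  transitivity (\sum_i u i * \sum_j (dirlin v (N i j) * (M j m)@_0 +
      (N i j)@_0 * dirlin v (M j m))).
    under [RHS]eq_bigr => i _ do rewrite big_split mulrDr /= !mulr_sumr.
    rewrite big_split /= [X in _ = _ + X]exchange_big [X in _ = _ + X]big1 /= ?addr0.
      rewrite exchange_big; apply: eq_bigr => j _ /=; rewrite mcoeffZ mulr_suml.
      by apply: eq_bigr => i _; rewrite mulrA.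
    move=> j _; under eq_bigr => i _ do rewrite mulrA.
    by rewrite -mulr_suml hu mul0r.
  under eq_bigr => i _.
    under [X in _ * X]eq_bigr => j _ do rewrite -dirlinM.
    rewrite -dirlin_sum hNM.
    over.
  rewrite (bigD1 m) //= eqxx mul1r dirlin_lf hv mulr1 big1 ?addr0 // => i /negPf ->.
  by rewrite mul0r dirlin0 mulr0.
have minors := transition_minors hN.
case: (boolP [exists ij, (N ij.1 ij.2)@_0 != 0]) => [/existsP[[i0 j0] /= N00]|].
  exists i0 => k ki; pose u m := (m == k)%:R * (N i0 j0)@_0 - (m == i0)%:R * (N k j0)@_0.
  have [j|F [F0 Fu]] := lin u.
    under eq_bigr => i _ do rewrite mulrBl -!mulrA.
    rewrite sumrB (bigD1 k) //= [X in _ - X](bigD1 i0) //= !eqxx !mul1r.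
    rewrite !big1 ?addr0 => [|i /negPf ->|i /negPf ->]; rewrite ?mul0r //.
    by apply/eqP; rewrite subr_eq0 minors mulrC.
  exists F; split=> //; first by rewrite Fu /u eqxx (negPf ki) mul1r mul0r subr0.
  by move=> m /negPf mk /negPf mi; rewrite Fu /u mk mi !mul0r subr0.
rewrite negb_exists => /forallP N0.
(* When all constant terms of [N] vanish, any index will do; a nonzero coordinate of [a h] provides
   one. *)
have [i0 _] : exists i, a h 0 i != 0.
  apply/existsP; apply: contraT; rewrite negb_exists => /forallP h0.
  have := nonpar_neq0 np h; rewrite (_ : a h = 0) ?eqxx //.
  by apply/rowP => i; move: (h0 i); rewrite negbK mxE => /eqP.
exists i0 => k ki; have [j|F [F0 Fu]] := lin (fun m => (m == k)%:R).
  rewrite big1 // => i _; have := N0 (i, j); rewrite negbK /= => /eqP ->.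
  by rewrite mulr0.
exists F; split=> //; first by rewrite Fu eqxx oner_eq0.
by move=> m /negPf mk _; rewrite Fu mk.
Qed.

(* Graded Nakayama. *)
Lemma pivot_generates : exists i0, forall k, dvds (beta i0) (beta k).
Proof.
have [i0 rel] := pivot_relations; exists i0 => k.
have [_ hb] := fb; move: {-2}(d k) (erefl (d k)) => m.
elim/ltn_ind: m k => m IH k dk.
have [->|ki] := eqVneq k i0; first exact: dvds_refl.
have [F [F0 Fk Fm]] := rel k ki.
have bh i : beta i \is (d i).-homog by apply/proj_homog/app_homog.
have : dvds (beta i0) ((F k)@_0 *: beta k).
  have := congr1 (pihomog mdeg (d k)) F0.
  rewrite pihomog0 raddf_sum (bigD1 k) //= (pihomogM_homogr _ _ (bh k)) leqnn subnn.
  rewrite pihomog0_mcoeff mul_mpolyC => /eqP; rewrite addr_eq0 => /eqP ->.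
  apply: dvds_opp; apply: dvds_sum => i ik.
  rewrite (pihomogM_homogr _ _ (bh i)); case: leqP => [dik|_]; last exact: dvds0.
  have [->|ii0] := eqVneq i i0; first exact/dvds_mull/dvds_refl.
  move: dik; rewrite leq_eqVlt => /orP[/eqP ->|lt].
    by rewrite subnn pihomog0_mcoeff Fm // mpolyC0 mul0r; apply: dvds0.
  by apply: dvds_mull; apply: (IH (d i)) => //; rewrite dk.
move/(dvds_scale ((F k)@_0)^-1).
by rewrite scalerA mulVf // scale1r.
Qed.

Lemma dvds_mul2r p q f : f != 0 -> dvds (p * f) (q * f) -> dvds p q.
Proof. by move=> f0 [g e]; exists g; apply: (mulIf f0); rewrite e mulrA. Qed.

(** One index for each hyperplane of the restriction to [h]. *)
Definition reps := [set t in E | [pick s in par a E h t] == Some t].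

Lemma repsP s t : s \in reps -> t \in reps -> s \in clos a [set h; t] -> s = t.
Proof.
rewrite !inE => /andP[sE /eqP es] /andP[tE /eqP et] st.
have neh t' : t' \in E -> t' != h by apply: contraTneq => ->.
have : par a E h s = par a E h t.
  by apply: par_eq; rewrite ?neh // [_ \in par _ _ _ _]inE sE inE.
by move=> e; move: es; rewrite e et => -[].
Qed.

Lemma reps_nonempty t : t \in E -> exists r, r \in reps.
Proof.
have neh t' : t' \in E -> t' != h by apply: contraTneq => ->.
move=> tE; have [r hr] : exists r, [pick s in par a E h t] = Some r.
  by case: pickP => [r _|/(_ t)]; [exists r|rewrite mem_par].
have rp : r \in par a E h t by move: hr; case: pickP => // r' h' [<-].
have rE : r \in E by move: rp; rewrite inE => /andP[].
by exists r; rewrite inE rE (par_eq np _ _ rp) ?neh // hr eqxx.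
Qed.

(** Modulo [x], [I] is generated by [c i0]. Explicit derivations show that [c i0] divides, for every
    [r], the product of the restricted representatives other than [r]; these products have no common
    prime factor. *)
Lemma unimodular_of_free : unimodular a E h.
Proof.
have [c [h1 h2 h3 h4]] := pivot_coefs np hE fb hv.
have [i0 gen] := pivot_generates.
have neh t' : t' \in E -> t' != h by apply: contraTneq => ->.
have cancel th w : inD a E th -> rho (app th (a h)) = w * rho (tpol a E h) ->
    dvds (c i0) w.
  case: (fb) => -[_ bgen _] _ /bgen[u ->] e.
  apply: (dvds_mul2r (tpol_proj_neq0 np hE hv)); rewrite -e -h1.
  rewrite app_sum [X in dvds _ X](raddf_sum rho) /=; apply: dvds_sum => k _.
  by rewrite appZr rmorphM /=; apply/dvds_mull/gen.
(* The witness is a constant derivation along the hyperplane of [r] but transversal to [h],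
   multiplied by all other forms of [E]. *)
have other r : r \in reps -> dvds (c i0) (\prod_(t in reps :\ r) rho (lf (a t))).
  move=> rR; have rE : r \in E by move: rR; rewrite inE => /andP[].
  have [v' [hv' rv]] : exists v', dotv (a h) v' = 1 /\
      forall w : 'rV[K]_l, (w <= a r)%MS -> dotv w v' = 0.
    apply: dual_vector; apply/negP => /sub_rVP[q e].
    by have [_ /(_ h r)] := np; rewrite eq_sym neh // => /(_ isT q); rewrite e eqxx.
  apply: (cancel (\prod_(t in E :\ r) lf (a t) *: cst v')).
    apply: (inD_sub (E' := [set r] :|: (E :\ r))); first by rewrite setD1K.
    apply: inD_mulprod => t; rewrite in_set1 => /eqP ->.
    by rewrite app_cst rv ?submx_refl // mpolyC0; apply: dvds0.
  rewrite appZr app_cst hv' mpolyC1 mulr1 /tpol !rmorph_prod /=.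
  rewrite (big_setID (nonreps a E h)) /= mulrC.
  congr (_ * _); apply: eq_bigl => t; rewrite !inE.
    by case: (t \in E) => //=; case: eqP; rewrite ?andbF ?andbT //= andbC.
  case: (boolP (t \in E)) => //= tE; rewrite ?andbT ?andbF //.
  by case: (eqVneq t r) => //= ->; move: rR; rewrite inE rE /= => /eqP ->; rewrite eqxx.
(* A factor of the product over [M] either cancels or divides [c i0]; in the second case it would
   divide the product that omits it. *)
have reduce m : forall M, #|M| = m -> M \subset reps ->
    dvds (c i0) (\prod_(t in M) rho (lf (a t))) -> dvds (c i0) 1.
  elim: m => [|m IH] M eM /subsetP MR; first by rewrite (cards0_eq eM) big_set0.
  have /card_gt0P[r rM] : (0 < #|M|)%N by rewrite eM.
  have rR := MR _ rM; have rh : r != h by apply: neh; move: rR; rewrite inE => /andP[].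
  have [p0 pp] := proj_lf_prime np hv rh.
  rewrite (big_setD1 r) //= => -[w e].
  have : dvds (rho (lf (a r))) (w * c i0) by rewrite -e; apply/dvds_mulr/dvds_refl.
  case/pp => [[w' ew]|[q eq]].
    apply: (IH (M :\ r)).
    - by move: eM; rewrite (cardsD1 r) rM => -[].
    - by apply/subsetP => t; rewrite inE => /andP[_ /MR].
    - by exists w'; apply: (mulfI p0); rewrite e ew; ring.
  have : dvds (rho (lf (a r))) (\prod_(t in reps :\ r) rho (lf (a t))).
    by have [u ->] := other r rR; rewrite eq; apply/dvds_mull/dvds_mull/dvds_refl.
  case/(prime_dvds_prod _ (proj_lf_prime np hv rh)).
    by rewrite proj_lf; apply: lf_not1.
  move=> s; rewrite in_setD1 => /andP[sr sR] /(proj_lf_dvds np hv rh) /(repsP sR rR) e'.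
  by rewrite e' eqxx in sr.
have unit_c : dvds (c i0) 1.
  have [R0|/card_gt0P[r rR]] := posnP #|reps|.
    have E0 : E = set0.
      apply/eqP; apply: contraT => /set0Pn[t /reps_nonempty[r]].
      by rewrite (cards0_eq R0) inE.
    have D0 : inD a E (cst v) by move=> t; rewrite E0 inE.
    apply: (cancel _ _ D0); rewrite app_cst hv mpolyC1 rmorph1 mul1r.
    rewrite /tpol (_ : nonreps a E h = set0) ?big_set0 ?rmorph1 //.
    by apply/setP => t; rewrite E0 !inE.
  apply: (reduce _ reps erefl) => //; rewrite (big_setD1 r) //=.
  exact/dvds_mull/other.
have c0 : (c i0)@_0 != 0.
  case: unit_c => q /(congr1 (mcoeff 0)); rewrite mcoeff1 eqxx rmorphM /= => e.
  by apply/eqP => c0; move/eqP: e; rewrite c0 mulr0 oner_eq0.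
exact: (pivot_unimodular fb hv h1 h2 (pivot_degree h2 h3 c0) c0).
Qed.

End Deletion.

(** * Families with the same matroid *)

Lemma free_basis0 (K : fieldType) (l : nat) (T : finType) (a : T -> 'rV[K]_l) :
  free_basis a set0 (fun=> 0%N) (fun i => delta_mx 0 i).
Proof.
split; first split=> [i t|th _|c].
- by rewrite inE.
- by exists (fun i => th 0 i); rewrite {1}[th]row_sum_delta.
- move/rowP => e i; have := e i; rewrite summxE (bigD1 i) //= !mxE !eqxx mulr1.
  by rewrite big1 ?addr0 // => j ji; rewrite !mxE eq_sym (negPf ji) mulr0.
- move=> i j; rewrite mxE; case: eqP => _ /=; rewrite ?andbF ?eqxx /=.
    by case: eqP => _; [exact: dhomog1|exact: dhomog0].
  exact: dhomog0.
Qed.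

Section Transfer.

Variables (K : fieldType) (l : nat) (T : finType) (a b : T -> 'rV[K]_l).
Hypotheses (npa : nonpar a) (npb : nonpar b).
Hypothesis same : forall C, clos a C = clos b C.

Lemma nonreps_same E h : nonreps a E h = nonreps b E h.
Proof.
apply/setP => t; rewrite !in_set; congr (_ && (_ != _)).
by apply: eq_pick => s; rewrite /par same.
Qed.

Definition steps (s : seq T) := forall s1 h s2, s = s1 ++ h :: s2 ->
  unimodular a [set t in s1] h.

Lemma steps_rcons s h : steps (rcons s h) -> steps s /\ unimodular a [set t in s] h.
Proof.
move=> st; split=> [s1 h' s2 e|]; last by apply: (st s h [::]); rewrite cats1.
by apply: (st s1 h' (rcons s2 h)); rewrite e rcons_cat rcons_cons.
Qed.

Lemma set_rcons (s : seq T) h (Z : {set T}) : h \in Z ->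
  [set t in rcons s h] :&: Z = h |: ([set t in s] :&: Z).
Proof.
move=> hZ; apply/setP => t; rewrite !inE mem_rcons inE.
by case: (eqVneq t h) => [->|].
Qed.

Lemma set_rcons_out (s : seq T) h (Z : {set T}) : h \notin Z ->
  [set t in rcons s h] :&: Z = [set t in s] :&: Z.
Proof.
move=> hZ; apply/setP => t; rewrite !inE mem_rcons inE.
by case: (eqVneq t h) => [->|]; rewrite ?(negPf hZ) ?andbF.
Qed.

(** The inner induction along [s] provides the common degrees before [h] is added. The outer one, on
    the size of the flat, is applied to the whole sequence including [h] and gives the local
    conditions for [b] at smaller flats. *)
Lemma transfer_steps n C s : #|clos a C| = n -> uniq s -> steps s ->
  (exists d ba bb, free_basis a ([set t in s] :&: clos a C) d ba /\
     free_basis b ([set t in s] :&: clos a C) d bb) /\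
  (forall s1 h s2, s = s1 ++ h :: s2 -> h \in clos a C ->
     unimodular b ([set t in s1] :&: clos a C) h).
Proof.
elim/ltn_ind: n C s => n IHn C s eC; elim/last_ind: s => [_ _|s h IHs].
  split; last by case.
  have -> : [set t in [::]] :&: clos a C = set0.
    by apply/setP => t; rewrite !inE.
  by do 3!eexists; split; exact: free_basis0.
move=> us st; have := us; rewrite rcons_uniq => /andP[hs us'].
have [st' Uh] := steps_rcons st.
have [[d [ba [bb [fa fb]]]] hU] := IHs us' st'.
set E := [set t in s] :&: clos a C in fa fb.
pose Ub_at (s1 : seq T) h' := unimodular b ([set t in s1] :&: clos a C) h'.
have split_last : (h \in clos a C -> Ub_at s h) ->
    forall s1 h' s2, rcons s h = s1 ++ h' :: s2 -> h' \in clos a C -> Ub_at s1 h'.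
  move=> Uh' s1 h' s2; case/lastP: s2 => [|s2 h2].
    by rewrite cats1 => /rcons_inj[<- <-] /Uh'.
  by rewrite -rcons_cons -rcons_cat => /rcons_inj[e _]; apply: hU e.
case: (boolP (h \in clos a C)) => [hC|hC]; last first.
  rewrite set_rcons_out //; split; first by exists d, ba, bb.
  by apply: split_last; rewrite (negPf hC).
have hE : h \notin E by rewrite !inE (negPf hs).
have Ua : unimodular a E h by apply: unimodular_trace.
have Ub : unimodular b E h.
  case: (boolP (h \in clos b E)) => hsp; last exact: unimodular_outside.
  have hspa : h \in clos a E by rewrite same.
  have [D0 [i0 [i1 [i01 di0 di1]]]] := unimodular_degrees npa hE hspa fa Ua.
  rewrite nonreps_same in D0 di0.
  apply: (unimodular_of_local npb hE hsp fb _ D0 i01 di0 di1) => Z ZE hZ nsub.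
  have sub : clos a Z \subset clos a C.
    apply: clos_min; apply: subset_trans ZE _; rewrite subUset sub1set hC.
    exact: subsetIr.
  have -> : E :&: clos b Z = [set t in s] :&: clos a Z.
    by rewrite -same /E -setIA (setIidPr sub).
  have lt : (#|clos a Z| < n)%N.
    rewrite -eC; apply: proper_card; apply/properP; split=> //.
    move: nsub; rewrite -same => /subsetPn[t tE tZ]; exists t => //.
    by move: tE; rewrite inE => /andP[].
  have [_ hU'] := IHn _ lt Z (rcons s h) erefl us st.
  by apply: (hU' s h [::]); rewrite ?cats1 // same.
split; last exact: split_last.
rewrite set_rcons // -/E.
have [[i di] addA] := addition npa hE fa Ua.
have [_ addB] := addition npb hE fb Ub.
have [ba' fa'] := addA i di; rewrite nonreps_same in di.
have [bb' fb'] := addB i di.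
by exists (bump_at d i), ba', bb'.
Qed.

(** Homogeneous bases of [l] elements are rebuilt from the empty arrangement by addition; the given
    bases only certify that each step is unimodular. *)
Lemma steps_of_free s : uniq s ->
  (forall s1 s2, s = s1 ++ s2 ->
     exists n (phi : 'I_n -> _), is_basis (inD a [set t in s1]) phi) ->
  steps s /\ exists d ba, free_basis a [set t in s] d ba.
Proof.
elim/last_ind: s => [_ _|s h IHs].
  split; first by case.
  have -> : [set t in [::]] = set0 :> {set T} by apply/setP => t; rewrite !inE.
  by do 2!eexists; exact: free_basis0.
rewrite rcons_uniq => /andP[hs us] fr.
have [|st [d [ba fa]]] := IHs us.
  by move=> s1 s2 e; apply: (fr s1 (rcons s2 h)); rewrite e rcons_cat.
have hE : h \notin [set t in s] by rewrite inE.
have eqs : [set t in rcons s h] = h |: [set t in s].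
  by apply/setP => t; rewrite !inE mem_rcons inE.
have Uh : unimodular a [set t in s] h.
  have [n [phi hphi]] := fr (rcons s h) [::] (esym (cats0 _)).
  rewrite eqs in hphi; have [v hv] := dotv_ex (nonpar_neq0 npa h).
  exact: (unimodular_of_free npa hE fa hphi hv).
split.
  move=> s1 h' s2; case/lastP: s2 => [|s2 h2].
    by rewrite cats1 => /rcons_inj[<- <-].
  by rewrite -rcons_cons -rcons_cat => /rcons_inj[/st].
have [[i di] addA] := addition npa hE fa Uh.
have [ba' fa'] := addA i di; rewrite eqs; by exists (bump_at d i), ba'.
Qed.

Theorem transfer s : uniq s ->
  (forall s1 s2, s = s1 ++ s2 ->
     exists n (phi : 'I_n -> _), is_basis (inD a [set t in s1]) phi) ->
  forall s1 s2, s = s1 ++ s2 -> exists d bb, free_basis b [set t in s1] d bb.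
Proof.
move=> us fr s1 s2 e.
have [||st _] := @steps_of_free s1.
- by move: us; rewrite e cat_uniq => /andP[].
- by move=> s3 s4 e'; apply: (fr s3 (s4 ++ s2)); rewrite e e' catA.
have [|[d [ba [bb [_ fb]]]] _] := transfer_steps (C := setT) erefl _ st.
  by move: us; rewrite e cat_uniq => /andP[].
have cT : clos a setT = setT.
  by apply/setP => t; rewrite in_setT mem_clos.
by rewrite cT setIT in fb; exists d, bb.
Qed.

End Transfer.

(** * Hyperplanes and normal vectors *)

Section Hyperplanes.

Variables (K : fieldType) (l : nat).
Notation V := 'rV[K]_l.
Notation S := {mpoly K[l]}.

Definition form (n w : V) : K^o := dotv n w.

Lemma form_is_linear n : linear (form n).
Proof.
move=> c w w'; rewrite /form /dotv scaler_sumr -big_split.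
by apply: eq_bigr => i _; rewrite !mxE /= mulrDr mulrCA.
Qed.

HB.instance Definition _ n :=
  GRing.isLinear.Build K V K^o *:%R (form n) (form_is_linear n).

Definition is_normal (H : {vspace V}) n := n != 0 /\ forall w, (w \in H) = (dotv n w == 0).

Lemma memv_lker_form n w : (w \in lker (linfun (form n))) = (dotv n w == 0).
Proof. by rewrite memv_ker lfunE. Qed.

Lemma dim_lker_form n : n != 0 -> (\dim (lker (linfun (form n)))).+1 = l.
Proof.
move=> n0; have [v nv] := dotv_ex n0.
have := limg_ker_dim (linfun (form n)) fullv; rewrite capfv dimvf (_ : dim _ = l); last exact: mul1n.
suff -> : \dim (limg (linfun (form n))) = 1%N by rewrite addn1.
apply/eqP; rewrite eqn_leq; apply/andP; split.
  by apply: leq_trans (dimvS (subvf _)) _; rewrite dimvf.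
rewrite lt0n dimv_eq0; apply: contraTneq (memv_img (linfun (form n)) (memvf v)) => ->.
by rewrite memv0 lfunE /= /form nv oner_eq0.
Qed.

Lemma hyperplane_normal (H : {vspace V}) : (\dim H).+1 = l -> exists n, is_normal H n.
Proof.
move=> dH; pose B : 'M[K]_(\dim H, l) := \matrix_i (vbasis H)`_i.
have : kermx B^T != 0.
  rewrite -mxrank_eq0 mxrank_ker subn_eq0 -ltnNge.
  by apply: leq_ltn_trans (rank_leq_col _) _; rewrite dH.
case/rowV0Pn => n /sub_kermxP nB n0; exists n; split=> // w.
suff -> : H = lker (linfun (form n)) by apply: memv_lker_form.
apply/eqP; rewrite eqEdim; apply/andP; split; last first.
  by rewrite -ltnS dH dim_lker_form.
apply/subvP => {}w wH; rewrite memv_ker (coord_vbasis wH) linear_sum big1 //= => i _.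
rewrite linearZ /= lfunE /= /form; suff -> : dotv n (vbasis H)`_i = 0 by rewrite scaler0.
move/rowP/(_ i): nB; rewrite !mxE => e; rewrite -[RHS]e.
by apply: eq_bigr => j _; rewrite !mxE.
Qed.

Lemma der_apply_lf (t : 'rV[S]_l) n : der_apply t (lf n) = app t n.
Proof.
by apply: eq_bigr => i _; rewrite mderiv_lf mulrC mul_mpolyC.
Qed.

Lemma linform_polyE (f : 'Hom(V, K^o)) : exists n, linform_poly f = lf n /\
  forall w, f w = dotv n w.
Proof.
exists (\row_i (f (delta_mx 0 i) : K)); split.
  by apply: eq_bigr => i _; rewrite mxE.
move=> w; rewrite {1}[w]row_sum_delta linear_sum; apply: eq_bigr => i _.
by rewrite linearZ mxE /= mulrC.
Qed.

Lemma normal_unique H n n' : is_normal H n -> is_normal H n' -> exists c, n' = c *: n.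
Proof.
move=> [n0 hn] [n0' hn']; apply/sub_rVP; apply: contraT => /dual_vector[v [nv hv]].
have := hn' v; rewrite hn nv hv ?submx_refl // eqxx => /esym/eqP.
by move/eqP; rewrite oner_eq0.
Qed.

Lemma hyperplane_sub (H H' : {vspace V}) : (\dim H).+1 = l -> (\dim H').+1 = l -> (H <= H')%VS -> H = H'.
Proof.
move=> dH dH' sub; apply/eqP; rewrite eqEdim sub /=.
by rewrite -ltnS dH dH'.
Qed.

Section Family.

Variables (T : finType) (H : T -> {vspace V}) (a : T -> V).
Hypotheses (Hinj : injective H) (Hdim : forall t, (\dim (H t)).+1 = l)
  (Ha : forall t, is_normal (H t) (a t)).

Lemma in_D_family (A : {fset {vspace V}}) (E : {set T}) :
  (forall X, X \in A <-> exists2 t, t \in E & X = H t) ->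
  forall th, in_D A th <-> inD a E th.
Proof.
move=> AE th; split=> [h t tE|h X /AE[t tE ->] f kf].
  have [n [e en]] := linform_polyE (linfun (form (a t))).
  have kf : lker (linfun (form (a t))) = H t.
    by apply/vspaceP => w; rewrite memv_lker_form (Ha t).2.
  have HA : H t \in A by apply/AE; exists t.
  have [g] := h _ HA _ kf; rewrite e.
  suff -> : n = a t by rewrite der_apply_lf => ->; exists g.
  apply/rowP => i; have := en (delta_mx 0 i); rewrite lfunE /= /form /dotv.
  rewrite (bigD1 i) //= [X in _ = X](bigD1 i) //= !big1 => [|j ji|j ji];
    rewrite !mxE ?eqxx /= ?(negPf ji) ?mulr0 // !addr0 !mulr1.
  by move->.
have [n [e en]] := linform_polyE f.
have [c ec] : exists c, a t = c *: n.
  have n0 : n != 0.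
    have [v av] := dotv_ex (Ha t).1; apply: contraTneq (oner_neq0 K) => n0.
    have : v \in H t by rewrite -kf memv_ker en n0 /dotv big1 // => i _; rewrite mxE mul0r.
    by rewrite (Ha t).2 av => ->.
  apply: (@normal_unique (H t)) (Ha t); split=> // w.
  by rewrite -kf memv_ker en.
have c0 : c != 0.
  by have [a0 _] := Ha t; apply: contraNneq a0 => c0; rewrite ec c0 scale0r.
have [g hg] := h t tE; exists g; rewrite e der_apply_lf.
have -> : n = c^-1 *: a t by rewrite ec scalerA mulVf // scale1r.
by rewrite appZ lfZ hg scalerAr.
Qed.

Lemma nonpar_family : nonpar a.
Proof.
split=> [t|s t st c]; first exact: (Ha t).1.
apply: contra_neqN st => /eqP e; apply/esym/Hinj/hyperplane_sub => //.
by apply/subvP => w; rewrite !(Ha _).2 e dotvZl => /eqP ->; rewrite mulr0.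
Qed.

(** By duality, spans of normals correspond to intersections of hyperplanes; this is how the lattice
    sees the matroid. *)
Lemma mem_clos_family (C : {set T}) t :
  (t \in clos a C) = (\bigcap_(s in C) H s <= H t)%VS.
Proof.
rewrite inE; apply/idP/idP => [/spanv_lin[u e]|sub].
  apply/subvP => w hw; rewrite (Ha t).2 e; elim/big_rec: _ => [|s x sC /eqP IH].
    by rewrite /dotv big1 // => i _; rewrite mxE mul0r.
  rewrite dotvDl dotvZl IH addr0; suff : w \in H s.
    by rewrite (Ha s).2 => /eqP ->; rewrite mulr0.
  by apply: subvP hw; apply: (bigcapv_inf s).
apply: contraT => /dual_vector[v [tv sv]].
have : v \in (\bigcap_(s in C) H s)%VS.
  rewrite memvE; apply/subv_bigcapP => s sC; rewrite -memvE (Ha s).2 sv //.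
  exact: mem_spanv.
by move/(subvP sub); rewrite (Ha t).2 tv oner_eq0.
Qed.

End Family.

Lemma is_basis_iff (M M' : 'rV[S]_l -> Prop) n (b : 'I_n -> 'rV[S]_l) :
  (forall th, M th <-> M' th) -> is_basis M b -> is_basis M' b.
Proof. by move=> e [h1 h2 h3]; split=> // [i|th /e/h2 //]; apply/e. Qed.

End Hyperplanes.

Local Open Scope fset_scope.

(** * The intersection lattice determines the matroid *)

Section Lattice.

Variables (K : fieldType) (l : nat).
Notation V := 'rV[K]_l.
Implicit Types (A B C : {fset {vspace V}}) (X Y H : {vspace V}).

Lemma latticeP A X : reflect (exists2 C : {fset {vspace V}}, C `<=` A &
    X = (\bigcap_(H <- C) H)%VS) (X \in intersection_lattice A).
Proof.
rewrite /intersection_lattice; apply: (iffP (imfsetP _ _ _ _)) => [[C /=]|[C CA ->]]; first by rewrite fpowersetE => CA ->; exists C.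
by exists C => //=; rewrite fpowersetE.
Qed.

Lemma sub_bigcapP X C : reflect (forall H, H \in C -> (X <= H)%VS)
  (X <= \bigcap_(H <- C) H)%VS.
Proof.
rewrite big_seq_fsetE /=; apply: (iffP subv_bigcapP) => h => [H HC|H _].
  exact: (h [` HC] isT).
exact/h/valP.
Qed.

Lemma lattice_fullv A : (fullv : {vspace V}) \in intersection_lattice A.
Proof. by apply/latticeP; exists fset0; rewrite ?fsub0set // big_seq_fset0. Qed.

Lemma lattice_atom A H : H \in A -> H \in intersection_lattice A.
Proof.
move=> HA; apply/latticeP; exists [fset H]; first by rewrite fsub1set.
by rewrite big_seq_fset1.
Qed.

Lemma sub_atom A X : X \in intersection_lattice A -> X != fullv ->
  exists2 H, H \in A & (X <= H)%VS.
Proof.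
case/latticeP => C /fsubsetP CA ->; have [->|[H HC] _] := fset_0Vmem C.
  by rewrite big_seq_fset0 eqxx.
by exists H; [exact: CA|move/sub_bigcapP: (subvv (\bigcap_(H0 <- C) H0)%VS); apply].
Qed.

Section Iso.

Variables A B : {fset {vspace V}}.
Hypotheses (hA : is_arrangement A) (hB : is_arrangement B).
Variable f : intersection_lattice A -> intersection_lattice B.
Hypotheses (fbij : bijective f)
  (fle : forall X Y : intersection_lattice A, lattice_le (f X) (f Y) = lattice_le X Y).

Lemma hyperplane_neq_full C H : is_arrangement C -> H \in C -> H != fullv.
Proof.
move=> hC /hC dH; apply: contra_eq_neq dH => ->.
by rewrite dimvf (_ : dim _ = l) ?gtn_eqF //; exact: mul1n.
Qed.

Lemma iso_sub (X Y : intersection_lattice A) : (val (f X) <= val (f Y))%VS = (val X <= val Y)%VS.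
Proof. exact: fle. Qed.

Lemma full_sub (X Y : {vspace V}) : X = fullv -> (X <= Y)%VS -> Y = fullv.
Proof. by move=> -> sub; apply/eqP; rewrite eqEsubv subvf. Qed.

Lemma iso_full (X : intersection_lattice A) : (val (f X) == fullv) = (val X == fullv).
Proof.
have [g fK gK] := fbij; apply/eqP/eqP => e.
  apply: (@full_sub (val [` lattice_fullv A])) => //.
  by rewrite -iso_sub e subvf.
apply: (@full_sub (val [` lattice_fullv B])) => //.
by rewrite -(gK [` lattice_fullv B]) iso_sub e subvf.
Qed.

(** A hyperplane of [B] containing the image pulls back to a proper subspace between [val X] and
    some hyperplane of [A], and two nested hyperplanes coincide. *)
Lemma iso_atom (X : intersection_lattice A) : val X \in A -> val (f X) \in B.
Proof.
move=> XA; have [g fK gK] := fbij.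
have [|G GB XG] := sub_atom (valP (f X)); first by rewrite iso_full (hyperplane_neq_full hA).
pose Y := [` lattice_atom GB]; have fY : val (f (g Y)) = G by rewrite gK.
have XY : (val X <= val (g Y))%VS by rewrite -iso_sub fY.
have [|H HA YH] := sub_atom (valP (g Y)).
  by rewrite -iso_full fY (hyperplane_neq_full hB).
have XH : val X = H by apply: hyperplane_sub (subv_trans XY YH); exact: hA.
suff -> : X = g Y by rewrite fY.
by apply: val_inj; apply/eqP; rewrite eqEsubv XY XH.
Qed.

End Iso.

Lemma bigcap_lattice A (T : finType) (h : T -> {vspace V}) (C : {set T}) :
  (forall s, s \in C -> h s \in A) ->
  (\bigcap_(s in C) h s)%VS \in intersection_lattice A.
Proof.
move=> hC; apply/latticeP; exists [fset X in [seq h s | s <- enum C]].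
  apply/fsubsetP => X; rewrite !inE /= => /mapP[s]; rewrite mem_enum => sC ->.
  exact: hC.
apply/eqP; rewrite eqEsubv; apply/andP; split.
  apply/sub_bigcapP => X; rewrite !inE /= => /mapP[s]; rewrite mem_enum => sC ->.
  exact: (bigcapv_inf s).
apply/subv_bigcapP => s sC; move/sub_bigcapP: (subvv
  (\bigcap_(H <- [fset X in [seq h s | s <- enum C]]) H)%VS); apply.
by rewrite !inE /=; apply/mapP; exists s; rewrite ?mem_enum.
Qed.

(** Consecutive members differ by one hyperplane, so a filtration is an ordering of [A]; using [A]
    as index type lets both arrangements share it. *)
Lemma filtration_seq A n (F : nat -> {fset {vspace V}}) :
  F 0%N = fset0 -> F n = A -> (forall i, (i < n)%N -> F i `<=` F i.+1) ->
  (forall i, (i <= n)%N -> #|` F i| = i) ->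
  exists s : seq A, [/\ uniq s, size s = n &
    forall i, (i <= n)%N -> F i =i [seq val t | t <- take i s]].
Proof.
move=> F0 Fn Fsub Fcard.
have FA i : (i <= n)%N -> F i `<=` A.
  move=> le; rewrite -Fn -(subnKC le).
  have : (i + (n - i) <= n)%N by rewrite subnKC.
  elim: (n - i)%N => [|k IH]; first by rewrite addn0.
  by rewrite addnS => lt; apply: fsubset_trans (IH (ltnW lt)) (Fsub _ lt).
suff H m : (m <= n)%N -> exists s : seq A, [/\ uniq s, size s = m &
    forall i, (i <= m)%N -> F i =i [seq val t | t <- take i s]] by exact: H.
elim: m => [_|m IH lt].
  by exists [::]; split=> // i; rewrite leqn0 => /eqP -> x; rewrite F0 in_fset0.
have [s [us ss hs]] := IH (ltnW lt).
have : #|` F m.+1 `\` F m| = 1%N.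
  by rewrite cardfsDS ?Fsub // !Fcard // ?subSnn // ltnW.
move=> /eqP/cardfs1P[H eH].
have [HF1 HF] : H \in F m.+1 /\ H \notin F m.
  have : H \in F m.+1 `\` F m by rewrite eH inE.
  by rewrite inE => /andP[].
have HA : H \in A by apply: (fsubsetP (FA _ lt)).
exists (rcons s [` HA]); split; last 1 first.
- move=> i; rewrite leq_eqVlt => /orP[/eqP ->|]; last first.
    rewrite ltnS => le x; rewrite -cats1 takel_cat ?ss //; exact: hs.
  move=> x; rewrite take_oversize ?size_rcons ?ss // map_rcons mem_rcons inE /=.
  have -> : (x \in [seq val t | t <- s]) = (x \in F m).
    by rewrite hs // -ss take_size.
  have := congr1 (fun Z : {fset _} => x \in Z) eH; rewrite !inE.
  case: (boolP (x \in F m)) => [xF _|_ /= ->]; last by rewrite orbF.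
  by rewrite orbT; apply: (fsubsetP (Fsub _ lt)).
- rewrite rcons_uniq us andbT; apply: contraNN HF => Hs.
  by rewrite hs // -ss take_size; apply/mapP; exists [` HA].
by rewrite size_rcons ss.
Qed.

End Lattice.

(** * Carrying a filtration along a lattice isomorphism *)

Lemma filtration_transfer (K : fieldType) (l : nat)
    (A B : {fset {vspace 'rV[K]_l}}) :
  is_arrangement A -> is_arrangement B -> lattice_iso A B ->
  free_filtration A -> free_filtration B.
Proof.
move=> hA hB [f [fbij fle]] [n [F [F0 Fn Fsub Ffree]]].
have [g fK gK] := fbij.
have gbij : bijective g by exists f.
have gle X Y : lattice_le (g X) (g Y) = lattice_le X Y by rewrite -fle !gK.
have [s [us ss Fs]] := filtration_seq F0 Fn Fsub (fun i le => (Ffree i le).1).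
pose atom (t : A) : intersection_lattice A := [` lattice_atom (valP t)].
pose hb (t : A) : {vspace 'rV[K]_l} := val (f (atom t)).
have hbB t : hb t \in B by apply: (iso_atom hA hB fbij fle); exact: (valP t).
have hb_inj : injective hb.
  move=> t t' e; have : atom t = atom t' by apply/(bij_inj fbij)/val_inj.
  by move/(congr1 val) => /= /val_inj.
have hb_surj G : G \in B -> exists t, G = hb t.
  move=> GB; pose Y := [` lattice_atom GB].
  have gA : val (g Y) \in A by apply: (iso_atom hB hA gbij gle).
  exists [` gA]; rewrite /hb (_ : atom _ = g Y) ?gK //; exact: val_inj.
have dima (t : A) : (\dim (val t)).+1 = l by apply/hA/valP.
have dimb (t : A) : (\dim (hb t)).+1 = l by exact: (hB _ (hbB t)).
have : forall t : A, exists m, is_normal (val t) m.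
  by move=> t; apply: hyperplane_normal; apply: dima.
case/fin_all_exists => a ha.
have : forall t : A, exists m, is_normal (hb t) m.
  by move=> t; apply: hyperplane_normal; apply: dimb.
case/fin_all_exists => b hb'.
have npa := nonpar_family val_inj dima ha.
have npb := nonpar_family hb_inj dimb hb'.
have same C : clos a C = clos b C.
  apply/setP => t; rewrite (mem_clos_family ha) (mem_clos_family hb').
  pose X := [` bigcap_lattice (fun s (_ : s \in C) => valP s)].
  have inY : (\bigcap_(s in C) hb s)%VS \in intersection_lattice B.
    by apply: bigcap_lattice.
  (* An order isomorphism preserves intersections: one inclusion is monotonicity, the other pulls
     the intersection in [B] back along the inverse. *)
  suff eX : val (f X) = (\bigcap_(s in C) hb s)%VS.
    by rewrite -eX; have := iso_sub fle X (atom t) => /= ->.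
  apply/eqP; rewrite eqEsubv; apply/andP; split.
    apply/subv_bigcapP => s' sC; rewrite (iso_sub fle X (atom s')).
    exact: (bigcapv_inf s').
  rewrite -[X in (X <= _)%VS]/(val [` inY]) -(gK [` inY]) iso_sub //.
  apply/subv_bigcapP => s' sC; rewrite -[X in (_ <= X)%VS]/(val (atom s')).
  by rewrite -(iso_sub fle) gK /=; apply: (bigcapv_inf s').
have frA s1 s2 : s = s1 ++ s2 ->
    exists n (phi : 'I_n -> _), is_basis (inD a [set t in s1]) phi.
  move=> e; have le : (size s1 <= n)%N by rewrite -ss e size_cat leq_addr.
  have [_ [m [phi [hphi _]]]] := Ffree _ le; exists m, phi.
  apply: is_basis_iff hphi => th; apply: (in_D_family ha) => X.
  rewrite (Fs _ le) e take_size_cat //; split=> [/mapP[t ts ->]|[t]].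
    by exists t => //; rewrite inE.
  by rewrite inE => ts ->; apply/mapP; exists t.
have frB := transfer npa npb same us frA.
pose G i : {fset {vspace 'rV[K]_l}} := [fset X in [seq hb t | t <- take i s]].
exists n, G; split.
- by apply/fsetP => X; rewrite !inE take0.
- apply/fsetP => X; rewrite !inE /=; apply/mapP/idP => [[t _ ->] //|/hb_surj[t ->]].
  exists t => //; have : val t \in F n by rewrite Fn; exact: valP.
  by rewrite Fs // => /mapP[t' ts /val_inj ->].
- move=> i lt; apply/fsubsetP => X; rewrite !inE /= => /mapP[t ts ->].
  apply/mapP; exists t => //; move: ts; rewrite (take_nth t) ?ss // mem_rcons inE.
  by move->; rewrite orbT.
move=> i le; split.
  rewrite card_fseq undup_id ?size_map ?size_take ?ss; last first.
    by rewrite map_inj_uniq // take_uniq.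
  by case: ltngtP le.
have [d [phi [hphi hom]]] := frB _ _ (esym (cat_take_drop i s)).
exists l, phi; split; last by move=> j; exists (d j).
apply: is_basis_iff hphi => th; apply: iff_sym; apply: (in_D_family hb') => X.
rewrite !inE /=; split=> [/mapP[t ts ->]|[t]].
  by exists t => //; rewrite inE.
by rewrite inE => ts ->; apply/mapP; exists t.
Qed.

Theorem theorem1p13 (K : fieldType) (l : nat) (hl : (l <= 4)%N)
    (A B : {fset {vspace 'rV[K]_l}})
    (hA : is_arrangement A) (hAe : essential A)
    (hB : is_arrangement B) (hBe : essential B)
    (hAB : lattice_iso A B) :
  free_filtration A <-> free_filtration B.
Proof.
split; apply: filtration_transfer => //.
case: hAB => f [[g fK gK] fle]; exists g; split; first by exists f.
by move=> X Y; rewrite -fle !gK.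
Qed.
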